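(* Suppose $T$ is NIP and $p\in S^{\mathrm{inv}}_G(\mathcal{U},M)$ is strong right $f$-generic over $M$. Consider the conditions: (1) $p\cdot G(\mathcal{U})$ is closed; (2) $\overline{F_M(p)\cdot G(M)}\subseteq F_M(p\cdot G(\mathcal{U}))$ (closure taken in $S_G^{\mathrm{fs}}(\mathcal{U},M)$); (3) $\overline{F_M(p)\cdot G(M)}= F_M(p\cdot G(\mathcal{U}))$; (4) $F_M(p\cdot G(\mathcal{U}))$ is closed in $S_G^{\mathrm{fs}}(\mathcal{U},M)$; (5) $F_M(G(\mathcal{U})\cdot p^{-1})$ is a left ideal of $S_G^{\mathrm{fs}}(\mathcal{U},M)$; (6) $F_M(G(\mathcal{U})\cdot p^{-1})$ is a minimal left ideal and an Ellis subgroup of $S_G^{\mathrm{fs}}(\mathcal{U},M)$; (7) for all $q\in S^{\mathrm{inv}}_G(\mathcal{U},M)$, $F_M(p*q)^{-1}=F_M(q)^{-1}*F_M(p)^{-1}$; (8) $F_M(G(\mathcal{U})\cdot p^{-1})$ is an Ellis subgroup of $S_G^{\mathrm{fs}}(\mathcal{U},M)$; (9) $K_M|_{p\cdot G(\mathcal{U})}$ is an anti-isomorphism onto an Ellis subgroup of $S_G^{\mathrm{fs}}(\mathcal{U},M)$. Then (1) implies all the others; conditions (2)–(7) are equivalent to each other and imply (8) and (9); and (8) and (9) are equivalent.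
   Context: $\mathcal{U}$ monster model of $T$, $M\prec\mathcal{U}$ small, $G$ a group definable over $\emptyset$. $S_G^{\mathrm{inv}}(\mathcal{U},M)$ (resp. $S_G^{\mathrm{fs}}(\mathcal{U},M)$): global types on $G$ which are $M$-invariant (resp. finitely satisfiable in $M$), with the Stone topology. Newelski product: $\varphi(x,d)\in p*q$ iff $\varphi(x\cdot b,d)\in p$ where $b\models q|_{Md}$. Translates: $\varphi(x)\in c\cdot p\iff\varphi(c\cdot x)\in p$, $\varphi(x)\in p\cdot c\iff\varphi(x\cdot c)\in p$; $p\cdot A=\{p\cdot a:a\in A\}$, $A\cdot p$ similarly. $p^{-1}=\mathrm{tp}(a^{-1}/\mathcal{U})$ for $a\models p$. $p$ is strong right $f$-generic over $M$ if all right translates of $p$ by elements of $G(\mathcal{U})$ are $M$-invariant. Ellis subgroup: $u*I$ for $I$ a minimal left ideal and $u\in I$ idempotent. Anti-isomorphism: bijection $f$ with $f(ab)=f(b)f(a)$. Retraction $F_M$ (NIP): add predicate $\mathbf{P}$ for $M$, take a $|\mathcal{U}|^+$-saturated $(N',N)\succ(\mathcal{U},M)$; for $M$-invariant $p$ let $p|_N$ be the restriction to $N$ of its $M$-invariant extension to $N'$; $\theta(x,b)\in F_M(p)$ iff $\{\theta(x,b),\mathbf{P}(x)\}\cup p|_N$ is consistent; it is applied to sets elementwise. $K_M(p):=F_M(p^{-1})$. *)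

(* Defs.v *)
From HB Require Import structures.
From mathcomp Require Import all_boot.
From mathcomp Require Import all_classical.
From mathcomp Require Import topology.

Set Implicit Arguments.
Unset Strict Implicit.
Unset Printing Implicit Defensive.

Local Open Scope classical_set_scope.
Local Open Scope card_scope.

(** * First-order logic *)

Record language := Language {
  fsym : Type;
  rsym : Type;
  far : fsym -> nat;
  rar : rsym -> nat }.

Inductive term (L : language) (V : Type) : Type :=
| Var of V
| App (f : fsym L) of ('I_(far f) -> term L V).

(** Formulas with free variables in [V]; [fEx] binds the variable [None]. *)
Inductive formula (L : language) (V : Type) : Type :=
| fEq of term L V & term L V
| fRel (r : rsym L) of ('I_(rar r) -> term L V)
| fNot of formula L V
| fAnd of formula L V & formula L V
| fEx of formula L (option V).

Fixpoint tmap (L : language) (V W : Type) (g : V -> W) (t : term L V) :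
    term L W :=
  match t with
  | Var v => Var L (g v)
  | App f ts => App (fun i => tmap g (ts i))
  end.

Fixpoint fmap (L : language) (V W : Type) (g : V -> W) (phi : formula L V) :
    formula L W :=
  match phi with
  | fEq s t => fEq (tmap g s) (tmap g t)
  | fRel r ts => fRel (fun i => tmap g (ts i))
  | fNot f1 => fNot (fmap g f1)
  | fAnd f1 f2 => fAnd (fmap g f1) (fmap g f2)
  | fEx f1 => fEx (fmap (omap g) f1)
  end.

Fixpoint tvars (L : language) (V : Type) (t : term L V) : set V :=
  match t with
  | Var v => [set v]
  | App f ts => [set w | exists i, tvars (ts i) w]
  end.

Fixpoint fvars (L : language) (V : Type) (phi : formula L V) : set V :=
  match phi with
  | fEq s t => tvars s `|` tvars t
  | fRel r ts => [set w | exists i, tvars (ts i) w]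
  | fNot f1 => fvars f1
  | fAnd f1 f2 => fvars f1 `|` fvars f2
  | fEx f1 => [set w | fvars f1 (Some w)]
  end.

Record fostruct (L : language) := FOStruct {
  carrier :> Type;
  fint : forall f : fsym L, ('I_(far f) -> carrier) -> carrier;
  rint : forall r : rsym L, ('I_(rar r) -> carrier) -> Prop }.

Fixpoint teval (L : language) (U : fostruct L) (V : Type) (v : V -> U)
    (t : term L V) : U :=
  match t with
  | Var x => v x
  | App f ts => fint (fun i => teval v (ts i))
  end.

Fixpoint sat (L : language) (U : fostruct L) (V : Type) (v : V -> U)
    (phi : formula L V) : Prop :=
  match phi with
  | fEq s t => teval v s = teval v t
  | fRel r ts => rint (fun i => teval v (ts i))
  | fNot f1 => ~ sat v f1
  | fAnd f1 f2 => sat v f1 /\ sat v f2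
  | fEx f1 => exists a : U, sat (oapp v a) f1
  end.

Definition vsum (A B C : Type) (f : A -> C) (g : B -> C) (s : A + B) : C :=
  match s with inl a => f a | inr b => g b end.

(** [phi(v, y_0, ..., y_(n-1))] is sent to
    [exists y_0 ... y_(n-1), phi(v, y_0, ..., y_(n-1))]. *)
Fixpoint exblock (L : language) (n : nat) :
    forall V : Type, formula L (V + 'I_n) -> formula L V :=
  match n return forall V : Type, formula L (V + 'I_n) -> formula L V with
  | 0 => fun V phi =>
      fmap (vsum id (fun i : 'I_0 => False_rect V (notF (ltn_ord i)))) phi
  | m.+1 => fun V phi =>
      fEx (exblock (fmap (vsum (fun v => inl (Some v))
                               (fun i : 'I_m.+1 => if unlift ord0 i is Some k
                                                   then inr k else inl None))
                         phi))
  end.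

Lemma teval_tmap (L : language) (U : fostruct L) (V W : Type) (g : V -> W)
  (v : W -> U) (t : term L V) : teval v (tmap g t) = teval (v \o g) t.
Proof. by elim: t => //= f ts IH; congr fint; apply: funext. Qed.

Lemma sat_fmap (L : language) (U : fostruct L) (V W : Type) (g : V -> W)
  (v : W -> U) (phi : formula L V) : sat v (fmap g phi) = sat (v \o g) phi.
Proof.
elim: phi W g v => {V} [V s t|V r ts|V f IH|V f1 IH1 f2 IH2|V f IH] W g v /=.
- by rewrite !teval_tmap.
- by congr rint; apply: funext => i; rewrite teval_tmap.
- by rewrite IH.
- by rewrite IH1 IH2.
- congr ex; apply: funext => a; rewrite IH; congr sat.
  by apply: funext => -[].
Qed.

Lemma sat_exblock (L : language) (U : fostruct L) (n : nat) (V : Type)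
  (v : V -> U) (phi : formula L (V + 'I_n)) :
  sat v (exblock phi) <-> exists w : 'I_n -> U, sat (vsum v w) phi.
Proof.
elim: n V v phi => [|n IH] V v phi /=.
  rewrite sat_fmap; split=> [h|[w h]].
    exists (fun i : 'I_0 => False_rect U (notF (ltn_ord i))).
    by congr sat: h; apply: funext => -[] // [].
  by congr sat: h; apply: funext => -[] // [].
split=> [[a /IH [w]]|[w h]].
  rewrite sat_fmap => h.
  exists (fun i => if unlift ord0 i is Some k then w k else a).
  by congr sat: h; apply: funext => -[] //= i; case: unlift.
exists (w ord0); apply/IH; exists (fun k => w (lift ord0 k)).
rewrite sat_fmap; congr sat: h; apply: funext => -[] //= i.
by case: unliftP => [k ->|->].
Qed.

(** * Formulas with parameters, saturation, monster models *)

(** An [L(U)]-formula in the variables [x = (x_0, ..., x_(n-1))]: the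
    parameters from [U] are the free variables of the form [inr u]. *)
Definition pformula (L : language) (U : fostruct L) (n : nat) : Type :=
  formula L ('I_n + U).

Definition holds (L : language) (U : fostruct L) (n : nat)
    (phi : pformula U n) (a : 'I_n -> U) : Prop :=
  sat (vsum a id) phi.

Definition over (L : language) (U : fostruct L) (n : nat) (A : set U)
    (phi : pformula U n) : Prop :=
  forall u : U, fvars phi (inr u) -> A u.

Definition params (L : language) (U : fostruct L) (n : nat)
    (phi : pformula U n) : set U :=
  [set u | fvars phi (inr u)].

(** Consistency of a set of [L(U)]-formulas with the elementary diagram of
    [U], i.e. finite satisfiability in [U]. *)
Definition consistent (L : language) (U : fostruct L) (n : nat)
    (pi : set (pformula U n)) : Prop :=
  forall B : set (pformula U n), finite_set B -> B `<=` pi ->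
    exists a : 'I_n -> U, forall phi, B phi -> holds phi a.

Definition saturated (L : language) (U : fostruct L)
    (small : set U -> Prop) : Prop :=
  forall (n : nat) (A : set U) (pi : set (pformula U n)),
    small A -> (forall phi, pi phi -> over A phi) -> consistent pi ->
    exists a : 'I_n -> U, forall phi, pi phi -> holds phi a.

Definition card_lt (T1 T2 : Type) (A : set T1) (B : set T2) : Prop :=
  A #<= B /\ ~ (B #<= A).

Definition automorphism (L : language) (U : fostruct L) (s : U -> U) : Prop :=
  [/\ bijective s,
      forall (f : fsym L) (a : 'I_(far f) -> U), s (fint a) = fint (s \o a) &
      forall (r : rsym L) (a : 'I_(rar r) -> U), rint a <-> rint (s \o a)].

Definition partial_elementary (L : language) (U : fostruct L) (A : set U)
    (f : U -> U) : Prop :=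
  forall phi : formula L U, fvars phi `<=` A -> (sat id phi <-> sat f phi).

Definition strongly_homogeneous (L : language) (U : fostruct L)
    (small : set U -> Prop) : Prop :=
  forall (A : set U) (f : U -> U), small A -> partial_elementary A f ->
    exists s : U -> U, automorphism s /\ (forall a, A a -> s a = f a).

(** The cardinal [kappa] is represented by a type [K] of that cardinality;
    it is required to be greater than [|L| + aleph_0]. *)
Definition monster (L : language) (K : Type) (U : fostruct L) : Prop :=
  [/\ card_lt [set: nat] [set: K],
      card_lt [set: fsym L] [set: K] /\ card_lt [set: rsym L] [set: K],
      saturated (fun A : set U => card_lt A [set: K]) &
      strongly_homogeneous (fun A : set U => card_lt A [set: K])].

Definition elementary (L : language) (U1 U2 : fostruct L) (j : U1 -> U2) :
    Prop :=
  forall (V : Type) (v : V -> U1) (phi : formula L V),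
    sat v phi <-> sat (j \o v) phi.

Definition closed_under (L : language) (U : fostruct L) (M : set U) : Prop :=
  forall (f : fsym L) (a : 'I_(far f) -> U),
    (forall i, M (a i)) -> M (fint a).

Definition substruct (L : language) (U : fostruct L) (M : set U)
    (h : closed_under M) : fostruct L :=
  @FOStruct L {x : U | M x}
    (fun f a => exist M (fint (fun i => sval (a i)))
                        (h f _ (fun i => svalP (a i))))
    (fun r a => rint (fun i => sval (a i))).

Definition elementary_substruct (L : language) (U : fostruct L) (M : set U) :
    Prop :=
  exists h : closed_under M,
    elementary (U1 := substruct h) (fun x : {x : U | M x} => sval x : U).

(** NIP for the theory of [U]: no partitioned formula shatters an infinite
    set. *)
Definition NIP (L : language) (U : fostruct L) : Prop :=
  forall (k l : nat) (phi : formula L ('I_k + 'I_l)) (A : set ('I_k -> U)),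
    (forall B : set ('I_k -> U), B `<=` A ->
       exists b : 'I_l -> U,
         forall a, A a -> (sat (vsum a b) phi <-> B a)) ->
    finite_set A.

(** * Types and their spaces *)

(** Sets of [F]-formulas, topologised by the sets [[set p | p phi]]; the trace
    of this topology on a set of complete types is the Stone topology. *)
Definition stone (F : Type) : Type := set F.

HB.instance Definition _ (F : Type) := Choice.copy (stone F) (set F).

HB.instance Definition _ (F : Type) :=
  isSubBaseTopological.Build (stone F)
    (range (fun phi : F => [set p : stone F | p phi])) id.

(** Closure and closedness of [A] relative to the subspace [S]. *)
Definition closure_in (T : topologicalType) (S A : set T) : set T :=
  closure (A : set (subspace S)).

Definition closed_in (T : topologicalType) (S A : set T) : Prop :=
  closed (A : set (subspace S)).

Definition typ (L : language) (U : fostruct L) (n : nat) : Type :=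
  stone (pformula U n).

Definition complete_type (L : language) (U : fostruct L) (n : nat)
    (p : typ U n) : Prop :=
  consistent p /\ (forall phi, p phi \/ p (fNot phi)).

Definition same_type (L : language) (U : fostruct L) (A : set U) (k : nat)
    (b c : 'I_k -> U) : Prop :=
  forall phi : pformula U k, over A phi -> (holds phi b <-> holds phi c).

(** [phi(x, y)] is sent to [phi(x, b)]. *)
Definition inst (L : language) (U : fostruct L) (n k : nat)
    (phi : formula L ('I_n + 'I_k)) (b : 'I_k -> U) : pformula U n :=
  fmap (vsum inl (fun i => inr (b i))) phi.

Definition invariant (L : language) (U : fostruct L) (n : nat) (A : set U)
    (p : typ U n) : Prop :=
  forall (k : nat) (phi : formula L ('I_n + 'I_k)) (b c : 'I_k -> U),
    same_type A b c -> (p (inst phi b) <-> p (inst phi c)).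

Definition finitely_satisfiable_in (L : language) (U : fostruct L) (n : nat)
    (A : set U) (p : typ U n) : Prop :=
  forall phi, p phi -> exists a : 'I_n -> U, (forall i, A (a i)) /\ holds phi a.

Definition realizes (L : language) (U : fostruct L) (n : nat)
    (b : 'I_n -> U) (q : typ U n) : Prop :=
  forall phi, q phi -> holds phi b.

Definition restrict_type (L : language) (U : fostruct L) (n : nat) (A : set U)
    (q : typ U n) : typ U n :=
  [set phi | q phi /\ over A phi].

(** * Definable groups *)

(** A group definable over the empty set, living on n-tuples;
    [gmul(x, y, z)] defines the graph of [x * y = z] for [x], [y] in [G]. *)
Record defgroup (L : language) (U : fostruct L) (n : nat) := DefGroup {
  gdom : formula L 'I_n;
  gmul : formula L ('I_n + 'I_n + 'I_n);
  ginG := (fun a : 'I_n -> U => sat a gdom) : set ('I_n -> U);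
  gprod := fun a b c : 'I_n -> U => sat (vsum (vsum a b) c) gmul;
  gprod_fun : forall a b, ginG a -> ginG b ->
    exists2 c, ginG c & forall c', gprod a b c' <-> c' = c;
  gprodA : forall a b c ab bc abc, ginG a -> ginG b -> ginG c ->
    gprod a b ab -> gprod b c bc -> gprod ab c abc -> gprod a bc abc;
  gunitV : exists2 e, ginG e & forall a, ginG a ->
    [/\ gprod e a a, gprod a e a &
        exists2 a', ginG a' & gprod a a' e /\ gprod a' a e] }.

Section Group.
Variables (L : language) (U : fostruct L) (n : nat) (G : defgroup U n).

(** If [gam(x, y)] defines the graph of a function [y = t(x)], this is
    [phi(t(x))], written [exists y, gam(x, y) /\ phi(y)]. *)
Definition subst_graph (gam : formula L (('I_n + U) + 'I_n))
    (phi : pformula U n) : pformula U n :=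
  exblock (fAnd gam (fmap (vsum inr (fun u => inl (inr u))) phi)).

(** [phi(x * c)] *)
Definition fmulr (c : 'I_n -> U) (phi : pformula U n) : pformula U n :=
  subst_graph
    (fmap (vsum (vsum (fun i => inl (inl i)) (fun i => inl (inr (c i)))) inr)
          (gmul G)) phi.

(** [phi(c * x)] *)
Definition fmull (c : 'I_n -> U) (phi : pformula U n) : pformula U n :=
  subst_graph
    (fmap (vsum (vsum (fun i => inl (inr (c i))) (fun i => inl (inl i))) inr)
          (gmul G)) phi.

(** [phi(x^-1)]; the graph of the inverse is defined by
    [y \in G /\ exists z, x * y = z /\ z * z = z]. *)
Definition finv_subst (phi : pformula U n) : pformula U n :=
  let x i : (('I_n + U) + 'I_n) + 'I_n := inl (inl (inl i)) in
  let y i : (('I_n + U) + 'I_n) + 'I_n := inl (inr i) in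
  let z i : (('I_n + U) + 'I_n) + 'I_n := inr i in
  subst_graph
    (fAnd (fmap inr (gdom G))
          (exblock (fAnd (fmap (vsum (vsum x y) z) (gmul G))
                         (fmap (vsum (vsum z z) z) (gmul G))))) phi.

Definition typ_mulr (p : typ U n) (c : 'I_n -> U) : typ U n :=
  [set phi | p (fmulr c phi)].

Definition typ_mull (c : 'I_n -> U) (p : typ U n) : typ U n :=
  [set phi | p (fmull c phi)].

Definition typ_inv (p : typ U n) : typ U n :=
  [set phi | p (finv_subst phi)].

Definition typ_orbr (p : typ U n) (A : set ('I_n -> U)) : set (typ U n) :=
  [set typ_mulr p a | a in A].

Definition typ_orbl (A : set ('I_n -> U)) (p : typ U n) : set (typ U n) :=
  [set typ_mull a p | a in A].

(** [G(M)] *)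
Definition gpoints (M : set U) : set ('I_n -> U) :=
  [set a | ginG G a /\ forall i, M (a i)].

(** The spaces [S_G(U)], [S_G^inv(U, M)] and [S_G^fs(U, M)]. *)
Definition SG : set (typ U n) :=
  [set p | complete_type p /\ p (fmap inl (gdom G))].

Definition Sinv (M : set U) : set (typ U n) := SG `&` invariant M.

Definition Sfs (M : set U) : set (typ U n) :=
  SG `&` finitely_satisfiable_in M.

Definition newelski (M : set U) (p q : typ U n) : typ U n :=
  [set phi | exists2 b : 'I_n -> U,
     realizes b (restrict_type (M `|` params phi) q) & p (fmulr b phi)].

Definition strong_right_fgeneric (M : set U) (p : typ U n) : Prop :=
  forall c, ginG G c -> invariant M (typ_mulr p c).

End Group.

(** * Pairs and the retraction *)

(** [L] with an additional unary predicate [None]. *)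
Definition Lpair (L : language) : language :=
  @Language (fsym L) (option (rsym L)) (@far L) (oapp (@rar L) 1).

Fixpoint tlift (L : language) (V : Type) (t : term L V) : term (Lpair L) V :=
  match t with
  | Var v => Var (Lpair L) v
  | App f ts => @App (Lpair L) V f (fun i => tlift (ts i))
  end.

Fixpoint flift (L : language) (V : Type) (phi : formula L V) :
    formula (Lpair L) V :=
  match phi with
  | fEq s t => fEq (tlift s) (tlift t)
  | fRel r ts => @fRel (Lpair L) V (Some r) (fun i => tlift (ts i))
  | fNot f1 => fNot (flift f1)
  | fAnd f1 f2 => fAnd (flift f1) (flift f2)
  | fEx f1 => fEx (flift f1)
  end.

Definition fP (L : language) (V : Type) (v : V) : formula (Lpair L) V :=
  @fRel (Lpair L) V None (fun=> Var (Lpair L) v).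

Definition pair_struct (L : language) (U : fostruct L) (M : set U) :
    fostruct (Lpair L) :=
  @FOStruct (Lpair L) U (@fint L U)
    (fun r => match r return ('I_(oapp (@rar L) 1 r) -> U) -> Prop with
              | Some s => fun a => rint a
              | None => fun a => M (a ord0)
              end).

Definition reduct (L : language) (N : fostruct (Lpair L)) : fostruct L :=
  @FOStruct L N (@fint (Lpair L) N) (fun r => @rint (Lpair L) N (Some r)).

(** The interpretation of the added predicate. *)
Definition Ppart (L : language) (N : fostruct (Lpair L)) : set (reduct N) :=
  [set u | @rint (Lpair L) N None (fun=> u)].

Section Retraction.
Variables (L : language) (U : fostruct L) (M : set U).
(** [N'] is the pair [(N', N)], with [N = Ppart N']. *)
Variables (N' : fostruct (Lpair L)) (j : U -> reduct N') (n : nat).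

Definition fext (phi : pformula U n) : pformula (reduct N') n :=
  fmap (vsum inl (fun u => inr (j u))) phi.

(** [r] is the [M]-invariant extension of [p] to [N']. *)
Definition inv_extension (p : typ U n) (r : typ (reduct N') n) : Prop :=
  [/\ complete_type r, invariant (j @` M) r & forall phi, p phi -> r (fext phi)].

Definition retraction (p : typ U n) : typ U n :=
  [set theta | exists2 r : typ (reduct N') n, inv_extension p r &
     consistent (U := N')
       ([set flift (fext theta)]
        `|` range (fun i : 'I_n => fP L (inl i : 'I_n + N'))
        `|` [set flift psi | psi in restrict_type (Ppart (N := N')) r])].

End Retraction.

(** * Ellis semigroups *)

Section Ellis.
Variables (T : Type) (S : set T) (op : T -> T -> T).

Definition left_ideal (I : set T) : Prop :=
  [/\ I !=set0, I `<=` S & forall s x, S s -> I x -> I (op s x)].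

Definition minimal_left_ideal (I : set T) : Prop :=
  left_ideal I /\ forall J : set T, left_ideal J -> J `<=` I -> J = I.

Definition Ellis_subgroup (E : set T) : Prop :=
  exists I u, [/\ minimal_left_ideal I, I u, op u u = u & E = op u @` I].

Definition anti_isomorphism (D E : set T) (f : T -> T) : Prop :=
  [/\ forall x y, D x -> D y -> D (op x y),
      set_bij D E f &
      forall x y, D x -> D y -> f (op x y) = op (f y) (f x)].

End Ellis.

(* Main.v *)
Require Import Defs.
From mathcomp Require Import all_boot.
From mathcomp Require Import all_classical.
From mathcomp Require Import topology.

(** Write [p g] for right translates. Since [p] and all its translates are
    [M]-invariant, [p g] only depends on the type of [g] over [M]; hence the
    kernel of the action of [G(U)] on [p G(U)] (the relation [gcong]) contains
    equality of types over [M], and every type over [M] has a class in the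
    quotient group of [G(U)] by [gcong]. Taking classes turns the product and
    the inverse of types into those of the quotient, is unchanged by [F_M],
    and is a bijection from [p G(U)], hence also from [F_M (G(U) p^-1)], onto
    the quotient. So inside [F_M (G(U) p^-1)] every identity between products
    can be checked on classes, and conditions (2)-(7) all reduce to
    [S^fs * F_M(p)^-1] being contained in [F_M (G(U) p^-1)] : the former set is
    the inverse of the closure of [F_M(p) G(M)].

    NIP is used once: if both [theta] and its negation were in [F_M(q)], one
    could find Morley sequences of [q] in [N] on which [theta] follows any
    prescribed pattern, so that [theta] would shatter a Morley sequence of [q]
    in [U]. This makes [F_M(q)] a complete type and [F_M] continuous, so that
    (1) implies (4). *)

Set Implicit Arguments.
Unset Strict Implicit.
Unset Printing Implicit Defensive.

Local Open Scope classical_set_scope.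
Local Open Scope card_scope.

(* These names are shadowed by the MathComp imports. *)
Local Notation fmap := Defs.fmap.
Local Notation over := Defs.over.
Local Notation invariant := Defs.invariant.

(** * Formulas *)

(** What separates (8) and (9) from (2)-(7) is membership, not algebra: a product identity can be
    read off in the quotient group only once both sides are known to lie in [F_M (G(U) p^-1)]. An
    Ellis subgroup is closed under its own products, which is enough for the anti-isomorphism;
    (2)-(7) ask that left multiplication by all of [S^fs] stays inside. In (7) this is carried by
    the finitely satisfiable [q]: [F_M] fixes them, so [F_M(q)^-1] runs through all of [S^fs].

    The pair [(N', N)] enters through first-order transfer from [(U, M)] and saturation of [N']. A
    formula with parameters [c] in [N'] is tested on a tuple [d] of [U] with the same type over [M];
    by invariance the choice of [d] does not matter. *)

Lemma finite_setE (T : Type) (A : set T) : finite_set A ->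
  exists k (g : 'I_k -> T), A = range g.
Proof.
move=> /(@finite_seqP {classic T}) [s ->]; exists (size s).
exists (tnth (in_tuple (s : seq {classic T}))).
apply/seteqP; split=> [x /= /(@tnthP _ _ (in_tuple s)) [i ->]|x [i _ <-]].
  by exists i.
exact: mem_tnth.
Qed.

Section Formulas.
Variable L : language.
Implicit Types (V : Type).

Lemma finite_tvars V (t : term L V) : finite_set (tvars t).
Proof.
elim: t => [v|f ts IH] /=; first exact: finite_set1.
have -> : [set w | exists i, tvars (ts i) w] = \bigcup_(i in setT) tvars (ts i).
  by apply/seteqP; split=> x /= [i]; [exists i|move=> _; exists i].
by apply: bigcup_finite => // ; exact: finite_finset.
Qed.

Lemma finite_fvars V (phi : formula L V) : finite_set (fvars phi).
Proof.
elim: phi => {V} [V s t|V r ts|V f IH|V f IHf g IHg|V f IH] //=.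
- by rewrite finite_setU; split; apply: finite_tvars.
- have -> : [set w | exists i, tvars (ts i) w] =
    \bigcup_(i in setT) tvars (ts i).
    by apply/seteqP; split=> x /= [i]; [exists i|move=> _; exists i].
  by apply: bigcup_finite => [|i _]; [exact: finite_finset|exact: finite_tvars].
- by rewrite finite_setU.
- apply: (@finite_preimage _ _ (fvars f) Some) => //.
Qed.

Lemma tvars_sub_range V W (g : W -> V) (t : term L V) :
  tvars t `<=` range g -> exists t', t = tmap g t'.
Proof.
elim: t => [v|f ts IH] /= h.
  by have [w _ <-] := h v erefl; exists (Var L w).
have /choice[ts' tsE] : forall i, exists t', ts i = tmap g t'.
  by move=> i; apply: IH => v vi; apply: h; exists i.
by exists (App ts'); rewrite /=; congr App; apply: funext.
Qed.

(** Parameters are free variables, so pulling a formula back along [g] trades them for other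
    variables. Under a quantifier the renaming becomes [omap g], hence the induction generalises [W]
    and [g]. *)
Lemma fvars_sub_range V W (g : W -> V) (phi : formula L V) :
  fvars phi `<=` range g -> exists phi', phi = fmap g phi'.
Proof.
elim: phi W g => {V} [V s t|V r ts|V f IH|V f1 IH1 f2 IH2|V f IH] W g /= h.
- have [|s' ->] := @tvars_sub_range _ _ g s; first by move=> v hv; apply: h; left.
  have [|t' ->] := @tvars_sub_range _ _ g t; first by move=> v hv; apply: h; right.
  by exists (fEq s' t').
- have /choice[ts' tsE] : forall i, exists t', ts i = tmap g t'.
    by move=> i; apply: tvars_sub_range => v vi; apply: h; exists i.
  by exists (fRel ts'); rewrite /=; congr fRel; apply: funext.
- by have [f' ->] := IH _ g h; exists (fNot f').
- have [|f1' ->] := IH1 _ g; first by move=> v hv; apply: h; left.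
  have [|f2' ->] := IH2 _ g; first by move=> v hv; apply: h; right.
  by exists (fAnd f1' f2').
- have [|f' ->] := IH _ (omap g); last by exists (fEx f').
  move=> [v|] hv; last by exists None.
  by have [w _ <-] := h v hv; exists (Some w).
Qed.

Lemma tvars_tmap V W (g : V -> W) (t : term L V) :
  tvars (tmap g t) `<=` g @` tvars t.
Proof.
elim: t => [v|f ts IH] /= w; first by move=> ->; exists v.
by move=> [i /IH[v hv <-]]; exists v => //; exists i.
Qed.

Lemma fvars_fmap V W (g : V -> W) (phi : formula L V) w :
  fvars (fmap g phi) w -> exists2 v, fvars phi v & g v = w.
Proof.
elim: phi W g w => {V} [V s t|V r ts|V f IH|V f1 IH1 f2 IH2|V f IH] W g w /=.
- by move=> [] /(@tvars_tmap _ _ g) [v hv <-]; exists v => //; [left|right].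
- by move=> [i /(@tvars_tmap _ _ g) [v hv <-]]; exists v => //; exists i.
- exact: IH.
- by move=> [/(IH1 _ g)|/(IH2 _ g)] [v hv <-]; exists v => //; [left|right].
- by move=> /(IH _ (omap g)) [[v|//]] hv [<-]; exists v.
Qed.

(** [R] is given uniformly in all structures, so one formula serves [U] and [N'] at once. The
    closure lemmas follow the shape of [R] and spare the writing of formulas with nested binders. *)
Definition expressible V (R : forall W : fostruct L, (V -> W) -> Prop) : Prop :=
  exists phi : formula L V, forall (W : fostruct L) (v : V -> W),
    sat v phi <-> R W v.

Lemma exp_sat V V' (h : forall W : fostruct L, (V -> W) -> V' -> W)
    (g : V' -> V) (phi : formula L V') :
  (forall (W : fostruct L) (v : V -> W) x, h W v x = v (g x)) ->
  expressible (fun W v => sat (h W v) phi).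
Proof.
move=> hg; exists (fmap g phi) => W v; rewrite sat_fmap.
by have -> : v \o g = h W v by apply: funext.
Qed.

Lemma exp_eq V (x y : V) : expressible (fun W v => v x = v y).
Proof. by exists (fEq (Var L x) (Var L y)). Qed.

Lemma exp_not V R : @expressible V R -> expressible (fun W v => ~ R W v).
Proof.
by move=> [f hf]; exists (fNot f) => W v /=; rewrite (propext (hf W v)).
Qed.

Lemma exp_and V R S : @expressible V R -> @expressible V S ->
  expressible (fun W v => R W v /\ S W v).
Proof.
move=> [f hf] [g hg]; exists (fAnd f g) => W v /=.
by rewrite (propext (hf W v)) (propext (hg W v)).
Qed.

Lemma exp_iff V R S : @expressible V R -> (forall W v, R W v <-> S W v) ->
  @expressible V S.
Proof. by move=> [f hf] h; exists f => W v; rewrite -(propext (h W v)). Qed.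

Lemma exp_imp V R S : @expressible V R -> @expressible V S ->
  expressible (fun W v => R W v -> S W v).
Proof.
move=> hR hS; apply: exp_iff (exp_not (exp_and hR (exp_not hS))) _ => W v.
by split=> [h r|h [r]]; [apply: contrapT => s; apply: h|apply; apply: h].
Qed.

Lemma exp_ex V k (R : forall W : fostruct L, (V -> W) -> ('I_k -> W) -> Prop) :
  expressible (fun W (u : V + 'I_k -> W) => R W (u \o inl) (u \o inr)) ->
  expressible (fun W v => exists a, R W v a).
Proof.
move=> [f hf]; exists (exblock f) => W v; rewrite (propext (sat_exblock v f)).
by split=> -[a ha]; exists a; move: ha; rewrite (propext (hf _ _)).
Qed.

Lemma exp_all V k (R : forall W : fostruct L, (V -> W) -> ('I_k -> W) -> Prop) :
  expressible (fun W (u : V + 'I_k -> W) => R W (u \o inl) (u \o inr)) ->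
  expressible (fun W v => forall a, R W v a).
Proof.
move=> hR; apply: exp_iff (exp_not (exp_ex (k := k)
  (R := fun W v a => ~ R W v a) (exp_not hR))) _ => W v.
split=> [h a|h [a]]; last by apply.
by apply: contrapT => na; apply: h; exists a.
Qed.

(** [V] may be empty and [L] without constants, so the only term at hand is a bound variable. *)
Lemma exp_true V : expressible (fun W (v : V -> W) => True).
Proof.
exists (fNot (fEx (fNot (fEq (Var L None) (Var L None))))) => W v /=.
by split=> // _ [a].
Qed.

Lemma exp_bigand V m (R : 'I_m -> forall W : fostruct L, (V -> W) -> Prop) :
  (forall i, expressible (R i)) ->
  expressible (fun W v => forall i, R i W v).
Proof.
elim: m R => [|m IH] R h.
  by apply: exp_iff (@exp_true V) _ => W v; split=> // _ [].
have h1 : forall i, expressible (R (lift ord0 i)) by move=> i; apply: h.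
apply: exp_iff (exp_and (h ord0) (IH _ h1)) _ => W v.
by split=> [[h0 h2] i|h2 //]; case: (unliftP ord0 i) => [k|] ->.
Qed.

(** The tuples may live in different structures. With [V] of the form ['I_k + {x | A x}] this is
    equality of types over [A]. *)
Definition eqtp V (U W : fostruct L) (v : V -> U) (w : V -> W) : Prop :=
  forall phi : formula L V, sat v phi <-> sat w phi.

Lemma eqtp_expP V (U W : fostruct L) (v : V -> U) (w : V -> W) R :
  eqtp v w -> expressible R -> R U v -> R W w.
Proof. by move=> vw [f hf] /hf /vw /hf. Qed.

Lemma eqtp_sym V (U W : fostruct L) (v : V -> U) (w : V -> W) :
  eqtp v w -> eqtp w v.
Proof. by move=> h phi; split=> /h. Qed.

Lemma eqtp_trans V (U1 U2 U3 : fostruct L) (v1 : V -> U1) (v2 : V -> U2)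
  (v3 : V -> U3) : eqtp v1 v2 -> eqtp v2 v3 -> eqtp v1 v3.
Proof. by move=> h1 h2 phi; split=> [/h1/h2|/h2/h1]. Qed.

Lemma eqtp_sub V V' (U W : fostruct L) (v : V -> U) (w : V -> W)
    (v' : V' -> U) (w' : V' -> W) (g : V' -> V) :
  eqtp v w -> (forall x, v' x = v (g x)) -> (forall x, w' x = w (g x)) ->
  eqtp v' w'.
Proof.
move=> h hv hw phi; have -> : v' = v \o g by apply: funext.
have -> : w' = w \o g by apply: funext.
by have := h (fmap g phi); rewrite !sat_fmap.
Qed.

End Formulas.

(** * Complete types *)

Section Types.
Variables (L : language) (U : fostruct L) (n : nat).
Implicit Types (p q : typ U n) (phi psi chi : pformula U n).

Lemma type_inhabited p : (forall phi, p phi \/ p (fNot phi)) -> p !=set0.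
Proof.
move=> pN; set phi : pformula U n := fEx (fEq (Var L None) (Var L None)).
by have [h|h] := pN phi; [exists phi|exists (fNot phi)].
Qed.

Lemma type_bigand p k (g : 'I_k -> pformula U n) : p !=set0 ->
  (forall phi psi, p phi -> p psi -> p (fAnd phi psi)) -> (forall i, p (g i)) ->
  exists2 psi, p psi & forall a, holds psi a -> forall i, holds (g i) a.
Proof.
move=> [phi pphi] pA; elim: k g => [|k IH] g gp.
  by exists phi => // a _ [].
have [psi hpsi h] := IH (fun i => g (lift ord0 i)) (fun i => gp _).
exists (fAnd (g ord0) psi); first exact: pA.
by move=> a /= [h0 h1] i; case: (unliftP ord0 i) => [l|] -> //; apply: h.
Qed.

Lemma complete_typeI p :
  (forall phi psi, p phi -> p psi -> p (fAnd phi psi)) ->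
  (forall phi, p phi -> exists a, holds phi a) ->
  (forall phi, p phi \/ p (fNot phi)) -> complete_type p.
Proof.
move=> pA pE pN; split=> // B /finite_setE[k [g ->]] gp.
have {gp}gp i : p (g i) by apply: gp; exists i.
have [psi /pE[a ha] h] := type_bigand (type_inhabited pN) pA gp.
by exists a => _ [i _ <-]; apply: h.
Qed.

(** Finite parts of [p] are realised in [U], so membership in [p] depends on solution sets in [U]
    only, never on syntax. *)
Lemma complete_and p phi psi chi : complete_type p -> p phi -> p psi ->
  (forall a, holds phi a -> holds psi a -> holds chi a) -> p chi.
Proof.
move=> [pC pN] hphi hpsi h; have [//|hchi] := pN chi.
have [||a ha] := pC ([set phi] `|` [set psi] `|` [set fNot chi]).
- by rewrite !finite_setU; do !split; apply: finite_set1.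
- by move=> ? [[->|->]|->].
have nh : ~ holds chi a by apply: (ha (fNot chi)); right.
by case: nh; apply: h; [apply: (ha phi)|apply: (ha psi)];
   left; [left|right].
Qed.

Lemma complete_mp p phi psi : complete_type p -> p phi ->
  (forall a, holds phi a -> holds psi a) -> p psi.
Proof. by move=> pC hphi h; apply: (complete_and pC hphi hphi) => a /h. Qed.

Lemma complete_sat p phi : complete_type p -> p phi -> exists a, holds phi a.
Proof.
move=> [pC _] hphi; have [|x ->|a ha] := pC [set phi] => //.
by exists a; apply: ha.
Qed.

Lemma complete_not p phi : complete_type p -> p (fNot phi) <-> ~ p phi.
Proof.
move=> pC; split=> [h h'|h]; last by have [/h|] := pC.2 phi.
have [a [+ nh]] : exists a, holds (fAnd phi (fNot phi)) a.
  by apply: (complete_sat pC); apply: (complete_and pC h' h).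
exact: nh.
Qed.

Lemma complete_sub_eq p q : complete_type p -> complete_type q ->
  p `<=` q -> p = q.
Proof.
move=> pC qC pq; apply/seteqP; split=> // phi qphi.
by have [//|/pq/(complete_not _ qC)] := pC.2 phi.
Qed.

(** As [inst], for an arbitrary type of parameter variables. *)
Definition pinst V (psi : formula L ('I_n + V)) (v : V -> U) : pformula U n :=
  fmap (vsum inl (fun x => inr (v x))) psi.

Lemma holds_pinst V (psi : formula L ('I_n + V)) (v : V -> U) a :
  holds (pinst psi v) a <-> sat (vsum a v) psi.
Proof.
rewrite /holds /pinst sat_fmap.
by have -> : vsum a id \o vsum inl (fun x => inr (v x)) = vsum a v
  by apply: funext => -[].
Qed.

Lemma finite_params (phi : pformula U n) : finite_set (params phi).
Proof.
apply: (@finite_preimage _ _ (fvars phi) inr); first by move=> x y _ _ [].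
exact: finite_fvars.
Qed.

Lemma pformulaE phi : exists k (psi : formula L ('I_n + 'I_k)) (c : 'I_k -> U),
  phi = inst psi c /\ forall i, params phi (c i).
Proof.
have [k [c cE]] := finite_setE (finite_params phi).
have [|psi E] := @fvars_sub_range L _ _
    (vsum inl (fun i => inr (c i)) : 'I_n + 'I_k -> 'I_n + U) phi.
  move=> [i|u] hu; first by exists (inl i).
  by have : params phi u by []; rewrite cE => -[i _ <-]; exists (inr i).
by exists k, psi, c; split=> // i; rewrite cE; exists i.
Qed.

(** [invariant] speaks of finite tuples; this cuts a family of parameters down to the finitely many
    that occur, by the same cut in every structure. *)
Lemma pinst_fin V (psi : formula L ('I_n + V)) :
  exists k (psi0 : formula L ('I_n + 'I_k)) (g : 'I_k -> V),
  forall (W : fostruct L) (u : V -> W) a,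
    sat (vsum a u) psi <-> sat (vsum a (u \o g)) psi0.
Proof.
have fin : finite_set [set x | fvars psi (inr x)].
  by apply: (@finite_preimage _ _ (fvars psi) inr) => // [x y _ _ []|];
     [|exact: finite_fvars].
have [k [g gE]] := finite_setE fin.
have [|psi0 E] := @fvars_sub_range L _ _
    (vsum inl (fun i => inr (g i)) : 'I_n + 'I_k -> 'I_n + V) psi.
  move=> [i|u] hu; first by exists (inl i).
  by have : [set x | fvars psi (inr x)] u by []; rewrite gE => -[i _ <-];
     exists (inr i).
exists k, psi0, g => W u a; rewrite E sat_fmap.
by have -> : vsum a u \o vsum inl (fun i => inr (g i)) = vsum a (u \o g)
  by apply: funext => -[].
Qed.

Lemma over_pinst V (psi : formula L ('I_n + V)) (v : V -> U) (A : set U) :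
  (forall x, A (v x)) -> over A (pinst psi v).
Proof.
by move=> hA u /(@fvars_fmap _ _ _ (vsum inl (fun x => inr (v x)))) [[i|x]] _
   //= [<-].
Qed.

End Types.

(** * Invariance for arbitrary families of parameters *)

Section SameType.
Variables (L : language) (U : fostruct L) (A : set U).

Lemma same_typeP k (b c : 'I_k -> U) : same_type A b c <->
  eqtp (vsum b (sval : {x | A x} -> U)) (vsum c (sval : {x | A x} -> U)).
Proof.
split=> h phi.
  have := h (pinst phi sval).
  by rewrite !(propext (holds_pinst _ _ _)); apply; apply: over_pinst => -[].
move=> hphi; have [|psi ->] := @fvars_sub_range L _ _
    (vsum inl (fun x => inr (sval x)) : 'I_k + {x | A x} -> 'I_k + U) phi.
  move=> [i|u] hu; first by exists (inl i).
  by exists (inr (exist _ u (hphi u hu))).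
rewrite -/(pinst psi sval); rewrite !(propext (holds_pinst _ _ _)).
exact: h.
Qed.

Variables (n : nat) (p : typ U n).
Hypotheses (pC : complete_type p) (pinv : invariant A p).

Lemma invariant_pinst V (psi : formula L ('I_n + V)) (v w : V -> U) :
  eqtp (vsum v (sval : {x | A x} -> U)) (vsum w (sval : {x | A x} -> U)) ->
  p (pinst psi v) -> p (pinst psi w).
Proof.
move=> vw hv; have [k [psi0 [g H]]] := pinst_fin psi.
have : p (inst psi0 (v \o g)).
  apply: (complete_mp pC hv) => a /holds_pinst/H.
  by rewrite -(propext (holds_pinst _ _ _)).
have : same_type A (v \o g) (w \o g).
  apply/same_typeP; apply: (eqtp_sub (g := fun x => match x with
    inl i => inl (g i) | inr y => inr y end) vw); by case.
move=> /pinv -> h; apply: (complete_mp pC h) => a.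
by move=> /(holds_pinst psi0)/H/holds_pinst.
Qed.

(** Invariance in semantic form: formulas built by substitution are compared with a property [R],
    without being brought into the form [inst]. *)
Lemma invariant_expP V (v w : V -> U)
    (R : forall W : fostruct L, ('I_n + (V + {x | A x}) -> W) -> Prop)
    (phi psi : pformula U n) :
  eqtp (vsum v (sval : {x | A x} -> U)) (vsum w (sval : {x | A x} -> U)) ->
  expressible R ->
  (forall a, holds phi a -> R U (vsum a (vsum v sval))) ->
  (forall a, R U (vsum a (vsum w sval)) -> holds psi a) ->
  p phi -> p psi.
Proof.
move=> vw [f hf] h1 h2 hp.
have : p (pinst f (vsum v sval)).
  by apply: (complete_mp pC hp) => a /h1 ?; apply/holds_pinst/hf.
have vw' : eqtp
    (vsum (vsum v (sval : {x | A x} -> U)) (sval : {x | A x} -> U))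
    (vsum (vsum w (sval : {x | A x} -> U)) (sval : {x | A x} -> U)).
  by apply: (eqtp_sub (g := vsum id inr) vw) => -[].
move=> /(invariant_pinst vw') h; apply: (complete_mp pC h) => a.
by move=> /holds_pinst/hf/h2.
Qed.

End SameType.

(** * Saturation *)

Section Cardinals.
Variable K : Type.
Hypothesis Kinf : card_lt [set: nat] [set: K].

Lemma card_lt_le (T S : Type) (A : set T) (B : set S) :
  A #<= B -> card_lt B [set: K] -> card_lt A [set: K].
Proof.
move=> AB [BK nKB]; split; first exact: card_le_trans AB BK.
by move=> KA; apply: nKB; exact: card_le_trans KA AB.
Qed.

Lemma infinite_inj (T : Type) (A : set T) : infinite_set A ->
  exists e : nat -> T, injective e /\ forall i, A (e i).
Proof.
move=> /infiniteP/card_leP[f].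
exists (fun i => val (f (SigSub (mem_setT i)))); split=> [i j|i]; last first.
  exact: set_valP.
move=> /val_inj h.
by have [] := @inj _ _ _ f _ _ (mem_setT _) (mem_setT _) h.
Qed.

Lemma infinite_setU1_le (T : Type) (A : set T) x : infinite_set A ->
  (A `|` [set x]) #<= A.
Proof.
move=> /infinite_inj[e [einj eA]].
(* [f] shifts the sequence [e] down by one and sends [e 0] to [x]; elsewhere it is the identity, so
   the image of [A] covers [A] and [x]. *)
pose f y := if pselect (exists i, y = e i) is left h
  then if projT1 (cid h) is i.+1 then e i else x else y.
have fe i : f (e i) = if i is i'.+1 then e i' else x.
  rewrite /f; case: pselect => [h|[]]; last by exists i.
  by case: (cid h) => k /= /einj <-.
apply: (card_le_trans _ (card_image_le f A)); apply: subset_card_le.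
move=> y [Ay|->]; last by exists (e 0); rewrite ?fe.
have [[i ->]|h] := pselect (exists i, y = e i); first by exists (e i.+1); rewrite ?fe.
by exists y => //; rewrite /f; case: pselect.
Qed.

Lemma infinite_setU_le (T : Type) (A B : set T) : infinite_set A ->
  finite_set B -> (A `|` B) #<= A.
Proof.
move=> Ainf /finite_setE[k [g ->]]; elim: k g => [|k IH] g.
  by apply: subset_card_le => x [//|[[]]].
apply: (card_le_trans _ (IH (fun i => g (lift ord0 i)))).
apply: (card_le_trans _ (@infinite_setU1_le _ _ (g ord0) _)).
  apply: subset_card_le => x [Ax|[i _ <-]]; first by left; left.
  case: (unliftP ord0 i) => [l|] ->; last by right.
  by left; right; exists l.
by apply: sub_infinite_set Ainf => x; left.
Qed.

Lemma countable_small (T : Type) (A : set T) :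
  countable A -> card_lt A [set: K].
Proof. by move=> cA; apply: card_lt_le cA Kinf. Qed.

Lemma small_setU (T : Type) (A B : set T) : card_lt A [set: K] ->
  finite_set B -> card_lt (A `|` B) [set: K].
Proof.
move=> hA fB; have [fA|iA] := pselect (finite_set A).
  by apply/countable_small/finite_set_countable; rewrite finite_setU.
by apply: card_lt_le hA; apply: infinite_setU_le.
Qed.

End Cardinals.

(** A finite part of the type of [d] over [w] has a solution; this is a first-order property of [w]
    and so passes to [v]. Saturation then realises the transported type. *)
Lemma saturated_extend (L : language) (U W : fostruct L)
    (small : set U -> Prop) (V : Type) (v : V -> U) (w : V -> W) k
    (d : 'I_k -> W) :
  saturated small -> small (range v) -> eqtp v w ->
  exists d' : 'I_k -> U, eqtp (vsum d' v) (vsum d w).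
Proof.
move=> hsat hsm vw.
have [|B /finite_setE[m [g ->]] gB|d' hd'] := hsat k (range v)
    [set phi | exists2 psi, phi = pinst psi v & sat (vsum d w) psi] hsm.
- by move=> _ [psi -> _]; apply: over_pinst => x; exists x.
- have /choice[psi hpsi] : forall i, exists psi : formula L ('I_k + V),
      g i = pinst psi v /\ sat (vsum d w) psi.
    by move=> i; have [|psi ? ?] := gB (g i); [exists i|exists psi].
  have E : expressible (fun W (v : V -> W) =>
      exists a : 'I_k -> W, forall i, sat (vsum a v) (psi i)).
    apply: (exp_ex (R := fun W v a => forall i, sat (vsum a v) (psi i))).
    apply: exp_bigand => i.
    by apply: (exp_sat (g := fun x => match x with
      inl x => inr x | inr x => inl x end)) => ? ? [].
  have [|a ha] := eqtp_expP (eqtp_sym vw) E.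
    by exists d => i; case: (hpsi i).
  exists a => _ [i _ <-]; rewrite (hpsi i).1; exact/holds_pinst.
exists d' => psi; split=> [h|h]; last first.
  by apply/holds_pinst; apply: hd'; exists psi.
apply: contrapT => nh.
have /holds_pinst /= : holds (pinst (fNot psi) v) d' by apply: hd'; exists (fNot psi).
exact.
Qed.

(** * Pairs *)

Section Lift.
Variable L : language.

Lemma sat_flift (N : fostruct (Lpair L)) V (v : V -> N) (phi : formula L V) :
  sat v (flift phi) <-> sat (U := reduct N) v phi.
Proof.
have tE V0 (v0 : V0 -> N) (t : term L V0) :
    teval v0 (tlift t) = teval (U := reduct N) v0 t.
  by elim: t => //= f ts IH; congr fint; apply: funext.
elim: phi v => {V} [V s t|V r ts|V f IH|V f1 IH1 f2 IH2|V f IH] v /=.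
- by rewrite !tE.
- by have -> : (fun i => teval v (tlift (ts i))) =
    (fun i => teval (U := reduct N) v (ts i)) by apply: funext.
- by rewrite (propext (IH v)).
- by rewrite (propext (IH1 v)) (propext (IH2 v)).
- by split=> -[a] /IH; exists a.
Qed.

Lemma sat_flift_pair (U : fostruct L) (M : set U) V (v : V -> U)
    (phi : formula L V) :
  sat (U := pair_struct M) v (flift phi) <-> sat v phi.
Proof.
have tE V0 (v0 : V0 -> U) (t : term L V0) :
    teval (U := pair_struct M) v0 (tlift t) = teval v0 t.
  by elim: t => //= f ts IH; congr fint; apply: funext.
elim: phi v => {V} [V s t|V r ts|V f IH|V f1 IH1 f2 IH2|V f IH] v /=.
- by rewrite !tE.
- by have -> : (fun i => teval (U := pair_struct M) v (tlift (ts i))) =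
    (fun i => teval v (ts i)) by apply: funext.
- by rewrite (propext (IH v)).
- by rewrite (propext (IH1 v)) (propext (IH2 v)).
- by split=> -[a] /IH; exists a.
Qed.

Lemma fvars_flift V (phi : formula L V) : fvars (flift phi) = fvars phi.
Proof.
have tE V0 (t : term L V0) : tvars (tlift t) = tvars t.
  elim: t => //= f ts IH; apply/seteqP.
  by split=> x [i]; rewrite ?IH => h; exists i; rewrite ?IH.
elim: phi => {V} [V s t|V r ts|V f IH|V f1 IH1 f2 IH2|V f IH] //=.
- by rewrite !tE.
- by apply/seteqP; split=> x [i]; rewrite ?tE => h; exists i; rewrite ?tE.
- by rewrite IH1 IH2.
- by rewrite IH.
Qed.

Lemma exp_P V (x : V) :
  @expressible (Lpair L) V (fun W v => Ppart (v x : reduct W)).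
Proof. by exists (fP L x). Qed.

Lemma exp_flift V V' (h : forall W : fostruct (Lpair L), (V -> W) -> V' -> W)
    (g : V' -> V) (phi : formula L V') :
  (forall (W : fostruct (Lpair L)) (v : V -> W) x, h W v x = v (g x)) ->
  @expressible (Lpair L) V (fun W v => sat (U := reduct W) (h W v) phi).
Proof.
move=> hg; apply: exp_iff (exp_sat (flift phi) hg) _ => W v.
exact: sat_flift.
Qed.

End Lift.

(** * Transfer between [(U, M)] and [(N', N)] *)

Section Pair.
Variables (L : language) (K : Type) (U : fostruct L) (hU : monster K U).
Variables (M : set U) (hM : elementary_substruct M).
Hypothesis hMsmall : card_lt M [set: K].
Variables (N' : fostruct (Lpair L)) (j : U -> reduct N').
Hypothesis hj : elementary (U1 := pair_struct M) (U2 := N') j.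

Local Notation Mt := {x : U | M x}.
Local Notation mU := (sval : Mt -> U).
Local Notation mN := (fun x : Mt => j (sval x)).
Local Notation P := (Ppart (N := N')).

Lemma j_eqtp V (v : V -> U) : eqtp v (fun x => j (v x)).
Proof.
move=> phi; have := hj v (flift phi).
by rewrite (propext (sat_flift_pair _ _ _)) => ->; apply: sat_flift.
Qed.

Lemma Ppart_j u : P (j u) <-> M u.
Proof. by have := hj (fun _ : unit => u) (fP L tt) => /= ->. Qed.

Lemma reduct_pair_sat V (v : V -> U) (phi : formula L V) :
  sat (U := reduct (pair_struct M)) v phi <-> sat v phi.
Proof. by rewrite -(propext (sat_flift _ _)) (propext (sat_flift_pair _ _ _)). Qed.

Lemma elementary_witness k l (phi : formula L ('I_k + 'I_l)) (a : 'I_k -> U)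
    (c : 'I_l -> U) : (forall i, M (c i)) -> sat (vsum a c) phi ->
  exists a', (forall i, M (a' i)) /\ sat (vsum a' c) phi.
Proof.
move=> Mc h; have [hcl el] := hM.
pose c0 i : substruct hcl := exist _ (c i) (Mc i).
have E : expressible (fun W (v : 'I_l -> W) =>
    exists a : 'I_k -> W, sat (vsum a v) phi).
  apply: (exp_ex (R := fun W v a => sat (vsum a v) phi)).
  by apply: (exp_sat (g := vsum inr inl)) => ? ? [].
have [||a' ha'] := eqtp_expP (v := c) (w := c0) _ E.
- by move=> psi; split=> /(el _ c0).
- by exists a.
exists (fun i => sval (a' i)); split=> [i|]; first exact: svalP.
have -> : vsum (fun i => sval (a' i)) c = (fun x => sval x) \o vsum a' c0.
  by apply: funext => -[].
exact/el.
Qed.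

(** For fixed [phi] the Tarski-Vaught property is a sentence about the pair, hence the variable type
    [void]; it passes from [(U, M)] to [(N', N)] and makes [N] elementary in [N']. *)
Lemma Ppart_witness k l (phi : formula L ('I_k + 'I_l)) (a : 'I_k -> reduct N')
    (c : 'I_l -> reduct N') : (forall i, P (c i)) -> sat (vsum a c) phi ->
  exists a', (forall i, P (a' i)) /\ sat (vsum a' c) phi.
Proof.
move=> Pc h.
pose R (W : fostruct (Lpair L)) (v : void -> W) :=
  forall c : 'I_l -> W, (forall i, Ppart (c i : reduct W)) ->
  (exists a : 'I_k -> W, sat (U := reduct W) (vsum a c) phi) ->
  exists a : 'I_k -> W, (forall i, Ppart (a i : reduct W)) /\
    sat (U := reduct W) (vsum a c) phi.
have E : expressible R.
  apply: exp_all; apply: exp_imp; first by apply: exp_bigand => i; apply: exp_P.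
  apply: exp_imp; apply: exp_ex.
    by apply: (exp_flift (g := vsum inr (fun x => inl (inr x)))) => ? ? [].
  apply: exp_and; first by apply: exp_bigand => i; apply: exp_P.
  by apply: (exp_flift (g := vsum inr (fun x => inl (inr x)))) => ? ? [].
have RU : R (pair_struct M) (of_void U).
  move=> c1 Pc1 [a1 /reduct_pair_sat/elementary_witness[//|a' [Ma' h']]].
  by exists a'; split=> //; apply/reduct_pair_sat.
have RN : R N' _ := eqtp_expP (hj (of_void U)) E RU.
by apply: (RN c Pc); exists a.
Qed.

(** Having a solution in the predicate is expressible in the pair language, so it descends along
    [j]; this is the source of finite satisfiability in [M]. *)
Lemma Ppart_reflect k V (phi : formula L ('I_k + V)) (a : 'I_k -> reduct N')
    (v : V -> U) : (forall i, P (a i)) -> sat (vsum a (fun x => j (v x))) phi ->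
  exists a', (forall i, M (a' i)) /\ sat (vsum a' v) phi.
Proof.
move=> Pa h.
pose R (W : fostruct (Lpair L)) (v : V -> W) :=
  exists a : 'I_k -> W, (forall i, Ppart (a i : reduct W)) /\
    sat (U := reduct W) (vsum a v) phi.
have E : expressible R.
  apply: exp_ex; apply: exp_and; first by apply: exp_bigand => i; apply: exp_P.
  by apply: (exp_flift (g := vsum inr inl)) => ? ? [].
have [||a' [Ma' /reduct_pair_sat ?]] := eqtp_expP (v := j \o v : V -> N')
    (w := v : V -> pair_struct M) _ E; last by exists a'.
- exact/eqtp_sym/hj.
- by exists a.
Qed.

Lemma range_sval_small : card_lt (range mU) [set: K].
Proof.
apply: card_lt_le hMsmall; apply: subset_card_le => _ [x _ <-]; exact: svalP.
Qed.

Lemma real_in_U k (c : 'I_k -> reduct N') :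
  exists c' : 'I_k -> U, eqtp (vsum c' mU) (vsum c mN).
Proof.
have [_ _ hsat _] := hU.
apply: (saturated_extend c hsat); first exact: range_sval_small.
exact: j_eqtp.
Qed.

(** Tuples are realised one after the other over those already chosen, which amalgamates separate
    realisations into a joint one. *)
Lemma real_in_U2 (W : fostruct L) (m : Mt -> W) (V : finType) l
    (c : V -> W) (d : 'I_l -> W) (c' : V -> U) :
  eqtp (vsum c' mU) (vsum c m) ->
  exists d' : 'I_l -> U, eqtp (vsum d' (vsum c' mU)) (vsum d (vsum c m)).
Proof.
have [Kinf _ hsat _] := hU.
move=> cc; apply: (saturated_extend d hsat _ cc).
apply: (card_lt_le _ (small_setU Kinf hMsmall
  (finite_image c' (@finite_finset _ [set: V])))).
apply: subset_card_le => _ [[i|m'] _ <-] /=; last by left; apply: svalP.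
by right; exists i.
Qed.

End Pair.

(** * The retraction *)

Section Retraction.
Variables (L : language) (K : Type) (U : fostruct L) (hU : monster K U).
Variables (M : set U) (hM : elementary_substruct M).
Hypothesis hMsmall : card_lt M [set: K].
Variables (N' : fostruct (Lpair L)) (j : U -> reduct N').
Hypothesis hj : elementary (U1 := pair_struct M) (U2 := N') j.
Hypothesis hN' : saturated (fun A : set N' => A #<= [set: U]).
Hypothesis hNIP : NIP U.
Variable n : nat.

Local Notation Mt := {x : U | M x}.
Local Notation mU := (sval : Mt -> U).
Local Notation mN := (fun x : Mt => j (sval x)).
Local Notation P := (Ppart (N := N')).
Local Notation F := (@retraction L U M N' j n).

Lemma holds_fext (phi : pformula U n) (a : 'I_n -> reduct N') :
  holds (fext j phi) a <-> sat (vsum a j) phi.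
Proof.
rewrite /holds /fext sat_fmap.
by have -> : vsum a id \o vsum inl (fun u => inr (j u)) = vsum a j
  by apply: funext => -[].
Qed.

Lemma fext_pinst V (psi : formula L ('I_n + V)) (v : V -> U) a :
  holds (fext j (pinst psi v)) a <-> sat (vsum a (fun x => j (v x))) psi.
Proof.
rewrite (propext (holds_fext _ _)) /pinst sat_fmap.
by have -> : vsum a j \o vsum inl (fun x => inr (v x)) =
  vsum a (fun x => j (v x)) by apply: funext => -[].
Qed.

Lemma eqtp_MW (W : fostruct L) (m : Mt -> W) (V V' : Type)
    (v : V -> U) (v' : V' -> U) (w : V -> W) (w' : V' -> W) :
  eqtp (vsum v (vsum v' mU)) (vsum w (vsum w' m)) ->
  eqtp (vsum v mU) (vsum w m).
Proof.
by move=> h; apply: (eqtp_sub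
  (g := vsum inl (fun x => inr (inr x))) h) => -[].
Qed.

(** * The retraction of a single invariant type *)

Section OneType.
Variable q : typ U n.
Hypotheses (qC : complete_type q) (qI : invariant M q).

(** [d1], [d2], [d3] are chosen independently, whereas the implication concerns [c1], [c2], [c3]
    jointly. A joint realisation is built around [d1]; invariance moves [q] onto it, the implication
    descends to it, and invariance moves the conclusion to [d3]. With equal premises this is
    monotonicity. *)
Lemma inv_ext_and k1 k2 k3 (f1 : formula L ('I_n + 'I_k1))
    (f2 : formula L ('I_n + 'I_k2)) (f3 : formula L ('I_n + 'I_k3))
    (c1 : 'I_k1 -> reduct N') (c2 : 'I_k2 -> reduct N')
    (c3 : 'I_k3 -> reduct N') (d1 : 'I_k1 -> U) (d2 : 'I_k2 -> U)
    (d3 : 'I_k3 -> U) :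
  eqtp (vsum d1 mU) (vsum c1 mN) -> eqtp (vsum d2 mU) (vsum c2 mN) ->
  eqtp (vsum d3 mU) (vsum c3 mN) -> q (inst f1 d1) -> q (inst f2 d2) ->
  (forall a, sat (vsum a c1) f1 -> sat (vsum a c2) f2 -> sat (vsum a c3) f3) ->
  q (inst f3 d3).
Proof.
move=> e1 e2 e3 q1 q2 h.
have [e2' he2] := real_in_U2 hU hMsmall c2 e1.
pose c12 : 'I_k2 + 'I_k1 -> reduct N' := vsum c2 c1.
pose d12 : 'I_k2 + 'I_k1 -> U := vsum e2' d1.
have e12 : eqtp (vsum d12 mU) (vsum c12 mN).
  by apply: (eqtp_sub (g := fun x => match x with
    | inl (inl x) => inl x | inl (inr x) => inr (inl x)
    | inr x => inr (inr x) end) he2) => -[[]|].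
have [e3' he3] := real_in_U2 hU hMsmall c3 e12.
have q2' : q (inst f2 e2').
  apply: (invariant_pinst qC qI _ q2).
  exact: (eqtp_trans e2 (eqtp_sym (eqtp_MW he2))).
have q3' : q (inst f3 e3').
  apply: (complete_and qC q1 q2') => a /(holds_pinst f1) h1 /(holds_pinst f2) h2.
  apply/(holds_pinst f3); move: a h1 h2.
  pose R (W : fostruct L) (v : 'I_k3 + ('I_k2 + 'I_k1 + Mt) -> W) :=
    forall a : 'I_n -> W, sat (vsum a (fun x => v (inr (inl (inr x))))) f1 ->
      sat (vsum a (fun x => v (inr (inl (inl x))))) f2 ->
      sat (vsum a (fun x => v (inl x))) f3.
  apply: (eqtp_expP (R := R) (eqtp_sym he3)); last exact: h.
  apply: exp_all; apply: exp_imp; last apply: exp_imp.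
  - by apply: (exp_sat (g := vsum inr (fun x => inl (inr (inl (inr x)))))) => ? ? [].
  - by apply: (exp_sat (g := vsum inr (fun x => inl (inr (inl (inl x)))))) => ? ? [].
  - by apply: (exp_sat (g := vsum inr (fun x => inl (inl x)))) => ? ? [].
apply: (invariant_pinst qC qI _ q3').
exact: (eqtp_trans (eqtp_MW he3) (eqtp_sym e3)).
Qed.

(** The presentation [psi], [c] of a formula is taken up to equivalence in [N'], so that membership
    depends on the solution set only. *)
Definition inv_ext : typ (reduct N') n :=
  [set phi | exists k (psi : formula L ('I_n + 'I_k)) c d,
     [/\ forall a, holds phi a <-> sat (vsum a c) psi,
         eqtp (vsum d mU) (vsum c mN) & q (inst psi d)]].

Lemma inv_ext_complete : complete_type inv_ext.
Proof.
apply: complete_typeI.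
- move=> phi1 phi2 [k1 [f1 [c1 [d1 [h1 e1 q1]]]]] [k2 [f2 [c2 [d2 [h2 e2 q2]]]]].
  have [k3 [f3 [c3 [E _]]]] := pformulaE (fAnd phi1 phi2).
  have [d3 e3] := real_in_U hU hMsmall hj c3.
  have H a : holds (fAnd phi1 phi2) a <-> sat (vsum a c3) f3.
    by rewrite E; apply: (holds_pinst f3).
  exists k3, f3, c3, d3; split=> //.
  by apply: (inv_ext_and e1 e2 e3 q1 q2) => a /h1 ? /h2 ?; apply/H.
- move=> phi [k [f [c [d [h e qf]]]]].
  have [a /(holds_pinst f) ha] := complete_sat qC qf.
  have E : expressible (fun W (v : 'I_k + Mt -> W) =>
      exists a : 'I_n -> W, sat (vsum a (v \o inl)) f).
    apply: (exp_ex (R := fun W v a => sat (vsum a (v \o inl)) f)).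
    by apply: (exp_sat (g := vsum inr (fun x => inl (inl x)))) => ? ? [].
  have [|b hb] := eqtp_expP e E; first by exists a.
  by exists b; apply/h.
- move=> phi; have [k [f [c [E _]]]] := pformulaE phi.
  have [d e] := real_in_U hU hMsmall hj c.
  have H a : holds phi a <-> sat (vsum a c) f.
    by rewrite E; apply: (holds_pinst f).
  have [hq|hq] := qC.2 (inst f d); [left|right].
    by exists k, f, c, d.
  exists k, (fNot f), c, d; split=> // a; rewrite /holds /=.
  by rewrite -(propext (H a)).
Qed.

Lemma inv_extP : inv_extension M j q inv_ext.
Proof.
split; first exact: inv_ext_complete.
- suff H k (phi : formula L ('I_n + 'I_k)) b c : same_type (j @` M) b c ->
      inv_ext (inst phi b) -> inv_ext (inst phi c).
    move=> k phi b c bc; split; first exact: H.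
    by apply: H => psi /bc[h1 h2].
  move=> /same_typeP bc [l [f [c1 [d1 [h1 e1 q1]]]]].
  have {}bc : eqtp (vsum b mN) (vsum c mN).
    by apply: (eqtp_sub (g := fun x => match x with inl x => inl x
      | inr x => inr (exist _ (j (sval x)) (imageP j (svalP x))) end) bc) => -[].
  have [b' eb] := real_in_U hU hMsmall hj b.
  exists k, phi, c, b'; split.
  - by move=> a; apply: (holds_pinst phi).
  - exact: eqtp_trans eb bc.
  - by apply: (inv_ext_and e1 e1 eb q1 q1) => a /h1/(holds_pinst phi).
- move=> phi; have [k [f [c [-> _]]]] := pformulaE phi => qf.
  exists k, f, (fun i => j (c i)), c; split=> // [a|].
    exact: (fext_pinst f).
  by apply: (eqtp_sub (g := id) (j_eqtp hj (vsum c mU))) => -[].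
Qed.

(** Uniqueness of the invariant extension: [j d] has over [M] the type of [d], hence that of [c],
    and [r] cannot tell [j d] from [c]. *)
Lemma inv_extension_inst r k (f : formula L ('I_n + 'I_k)) c d :
  inv_extension M j q r -> eqtp (vsum d mU) (vsum c mN) -> q (inst f d) ->
  r (inst f c).
Proof.
move=> [rC rI rE] e /rE h.
have {}h : r (inst f (fun i => j (d i))).
  by apply: (complete_mp rC h) => a /(fext_pinst f) ?; apply/(holds_pinst f).
apply: (invariant_pinst rC rI _ h).
have e' : eqtp (vsum (fun i => j (d i)) mN) (vsum c mN).
  apply: (eqtp_trans _ e); apply: eqtp_sym.
  by apply: (eqtp_sub (g := id) (j_eqtp hj (vsum d mU))) => -[].
have /choice[g hg] : forall x : {x | (j @` M) x}, exists y : Mt, sval x = j (sval y).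
  by move=> [x [y My yx]]; exists (exist _ y My).
by apply: (eqtp_sub (g := vsum inl (fun x => inr (g x))) e') => -[] //= x.
Qed.

(** Membership in [F q] without reference to the extension of [q] to [N'] :
    [q] is evaluated at realisations [d] in [U] of types over [M]. *)
Lemma retractionP theta : F q theta <->
  forall k (f : formula L ('I_n + 'I_k)) c d, (forall i, P (c i)) ->
    eqtp (vsum d mU) (vsum c mN) -> q (inst f d) ->
    exists a, [/\ forall i, P (a i), sat (vsum a j) theta & sat (vsum a c) f].
Proof.
split.
  move=> [r hr hcons] k f c d Pc e qf.
  have rf := inv_extension_inst hr e qf.
  have [||a ha] := hcons ([set flift (fext j theta)]
        `|` range (fun i : 'I_n => fP L (inl i : 'I_n + N'))
        `|` [set flift (inst f c)]).
  - rewrite !finite_setU; split; [split|]; try exact: finite_set1.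
    exact/finite_image/finite_finset.
  - move=> phi [hphi|->]; first by left.
    by right; exists (inst f c) => //; split=> //; apply: over_pinst.
  exists a; split.
  - move=> i; have : holds (U := N') (fP L (inl i : 'I_n + N')) a.
      by apply: ha; left; right; exists i.
    by [].
  - apply/holds_fext.
    by apply/(sat_flift (N := N')); apply: ha; left; left.
  - apply/(holds_pinst f).
    by apply/(sat_flift (N := N')); apply: ha; right.
move=> H; exists inv_ext; first exact: inv_extP.
have rC := inv_ext_complete.
move=> B /finite_setE[m [g ->]] gB.
(* A finite part of the set is summed up by one formula of the extension over [N]; [theta] and the
   predicate stay apart, as they do not come from the extension. *)
suff [psi [rpsi Ppsi hpsi]] : exists psi, [/\ inv_ext psi, over P psi &
    forall a : 'I_n -> reduct N', (forall i, P (a i)) -> sat (vsum a j) theta ->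
    holds psi a -> forall i, holds (U := N') (g i) a].
  have [k [f [c [E Pc]]]] := pformulaE psi.
  have [d e] := real_in_U hU hMsmall hj c.
  have qf : q (inst f d).
    move: rpsi => [k1 [f1 [c1 [d1 [h1 e1 q1]]]]].
    apply: (inv_ext_and e1 e1 e q1 q1) => a /h1 + _.
    by rewrite E => /(holds_pinst f).
  have [|a [Pa ha fa]] := H k f c d _ e qf; first by move=> i; apply/Ppsi/Pc.
  exists a => _ [i _ <-]; apply: hpsi => //.
  by rewrite E; apply/(holds_pinst f).
elim: m g gB => [|m IH] g gB.
  have [t ht] := exp_true L ('I_n + void).
  exists (pinst t (of_void _)); split=> [||a _ _ _ [//]].
    have [//|/complete_not] := rC.2 (pinst t (of_void (reduct N'))).
    move=> /(_ rC) nt.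
    have [a /=] := complete_sat rC (iffRL (complete_not _ rC) nt).
    by rewrite /holds /= => -[]; apply/holds_pinst/ht.
  by apply: over_pinst.
have [|psi [rpsi Ppsi hpsi]] := IH (fun i => g (lift ord0 i)).
  by move=> _ [i _ <-]; apply: gB; exists (lift ord0 i).
suff [chi [rchi Pchi hchi]] : exists chi, [/\ inv_ext chi, over P chi &
    forall a : 'I_n -> reduct N', (forall i, P (a i)) -> sat (vsum a j) theta ->
    holds chi a -> holds (U := N') (g ord0) a].
  exists (fAnd psi chi); split.
  - by apply: (complete_and rC rpsi rchi).
  - by move=> u [/Ppsi|/Pchi].
  - move=> a Pa ha [h1 h2] i; case: (unliftP ord0 i) => [l|] ->.
      exact: hpsi.
    exact: hchi.
have [||hg] := gB (g ord0); first by exists ord0.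
  move=> [->|[i _ <-]]; exists psi; split=> // a Pa ha _ //.
    by apply/(sat_flift (N := N'))/holds_fext.
  exact: Pa.
have [chi [rchi Pchi] <-] := hg.
exists chi; split=> // a _ _ h.
exact/(sat_flift (N := N')).
Qed.

Lemma retraction_witness V theta (f : formula L ('I_n + V)) c d :
  F q theta -> (forall x, P (c x)) ->
  eqtp (vsum d mU) (vsum c mN) -> q (pinst f d) ->
  exists a, [/\ forall i, P (a i), sat (vsum a j) theta & sat (vsum a c) f].
Proof.
move=> /retractionP H Pc e qf; have [k [f0 [g hf0]]] := pinst_fin f.
have [|||a [Pa ha fa]] := H k f0 (c \o g) (d \o g).
- by move=> i; apply: Pc.
- by apply: (eqtp_sub (g := fun x => match x with
    inl x => inl (g x) | inr x => inr x end) e) => -[].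
- apply: (complete_mp qC qf) => a /holds_pinst/hf0 ?; exact/(holds_pinst f0).
by exists a; split=> //; apply/hf0.
Qed.

Lemma retraction_extP theta : F q theta <->
  forall chi, inv_ext chi -> over P chi ->
    exists a, [/\ forall i, P (a i), sat (vsum a j) theta & holds chi a].
Proof.
split.
  move=> /retractionP H chi [k1 [f1 [c1 [d1 [h1 e1 q1]]]]] Pchi.
  have [k [f [c [E Pc]]]] := pformulaE chi.
  have [d e] := real_in_U hU hMsmall hj c.
  have [||a [Pa ha fa]] := H k f c d _ e.
  - by move=> i; apply/Pchi/Pc.
  - apply: (inv_ext_and e1 e1 e q1 q1) => a /h1 + _.
    by rewrite E => /(holds_pinst f).
  by exists a; split=> //; rewrite E; apply/(holds_pinst f).
move=> H; apply/retractionP => k f c d Pc e qf.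
have [||a [Pa ha fa]] := H (inst f c).
- exact: inv_extension_inst inv_extP e qf.
- exact: over_pinst.
by exists a; split=> //; apply/(holds_pinst f).
Qed.

Lemma retractionPn theta : ~ F q theta ->
  exists2 chi, inv_ext chi /\ over P chi &
    forall a, (forall i, P (a i)) -> holds chi a -> ~ sat (vsum a j) theta.
Proof.
move=> h; apply: contrapT => nh; apply: h; apply/retraction_extP => chi rchi Pchi.
apply: contrapT => na; apply: nh; exists chi => // a Pa ha hth.
by apply: na; exists a.
Qed.

Lemma inv_ext_Ppart chi : inv_ext chi -> over P chi ->
  exists2 a, forall i, P (a i) & holds chi a.
Proof.
move=> rchi Pchi; have [k [f [c [E Pc]]]] := pformulaE chi.
have [a] := complete_sat inv_ext_complete rchi.
rewrite E => /(holds_pinst f) ha.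
have [|b [Pb hb]] := Ppart_witness hM hj _ ha; first by move=> i; apply/Pchi/Pc.
by exists b => //; apply/(holds_pinst f).
Qed.

Lemma inv_ext_andP chi1 chi2 : inv_ext chi1 /\ over P chi1 ->
  inv_ext chi2 /\ over P chi2 ->
  inv_ext (fAnd chi1 chi2) /\ over P (fAnd chi1 chi2).
Proof.
move=> [r1 P1] [r2 P2]; split; last by move=> u [/P1|/P2].
exact: (complete_and inv_ext_complete r1 r2).
Qed.

(** Otherwise two formulas of the extension over [N] exclude [theta] and its negation on [N]; their
    conjunction has a solution in [N], as [N] is elementary in [N']. *)
Lemma retraction_total theta : F q theta \/ F q (fNot theta).
Proof.
apply: contrapT => /not_orP[/retractionPn[chi1 h1 H1] /retractionPn[chi2 h2 H2]].
have [r12 P12] := inv_ext_andP h1 h2.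
have [a Pa [a1 a2]] := inv_ext_Ppart r12 P12.
by apply: (H2 a Pa a2); apply: H1.
Qed.

Lemma finite_j_surj (u : reduct N') : finite_set [set: U] -> range j u.
Proof.
move=> /finite_setE[m [g gE]].
have E : @expressible L U (fun W v =>
    forall a : 'I_1 -> W, ~ forall i, a ord0 <> v (g i)).
  apply: exp_all.
  apply: exp_not; apply: exp_bigand => i; apply: exp_not.
  exact: (exp_eq L (inr ord0) (inl (g i))).
apply: contrapT => nu.
have H := eqtp_expP (j_eqtp hj (fun u : U => u)) E.
apply: (H _ (fun=> u)) => [a h|i ui]; last by apply: nu; exists (g i).
have : range g (a ord0) by rewrite -gE.
by move=> [i _ hi]; apply: (h i).
Qed.

(** Saturation of [N'] allows at most [|U|] parameters. For infinite [U] finitely many extra points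
    cost nothing; for finite [U] the embedding [j] is onto and there are no extra points. *)
Lemma range_mN_small (B : set (reduct N')) : finite_set B ->
  (range mN `|` B) #<= [set: U].
Proof.
move=> fB; have [fU|iU] := pselect (finite_set [set: U]).
  apply: (card_le_trans _ (card_image_le j _)); apply: subset_card_le => u _.
  exact: finite_j_surj.
have [fj|ij] := pselect (finite_set (range mN)).
  have : finite_set (range mN `|` B) by rewrite finite_setU.
  move=> /finite_set_countable h; apply: (card_le_trans h).
  exact/infiniteP.
apply: (card_le_trans (infinite_setU_le ij fB)).
apply: (@card_le_trans _ _ _ (range j)); last exact: card_image_le.
by apply: subset_card_le => _ [x _ <-]; exists (sval x).
Qed.

(** Saturation of [N'] upgrades finite consistency to one point of [N]. It prolongs [c] the way a
    realisation of [q] prolongs [d], with [theta] imposed on top. *)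
Lemma retraction_real (V : finType) theta (c : V -> reduct N') (d : V -> U) :
  F q theta -> (forall x, P (c x)) -> eqtp (vsum d mU) (vsum c mN) ->
  exists a, [/\ forall i, P (a i), sat (vsum a j) theta &
    forall f : formula L ('I_n + (V + Mt)),
      q (pinst f (vsum d mU)) -> sat (vsum a (vsum c mN)) f].
Proof.
move=> Fth Pc e.
pose Q := [set f : formula L ('I_n + (V + Mt)) | q (pinst f (vsum d mU))].
pose A : set (reduct N') := range mN `|` (range c `|` j @` params theta).
have [|||a ha] := hN' (n := n)
    (A := A)
    (pi := [set flift (fext j theta)]
        `|` range (fun i : 'I_n => fP L (inl i : 'I_n + N'))
        `|` [set flift (pinst f (vsum c mN)) | f in Q]).
- apply: range_mN_small; rewrite finite_setU; split.
    exact/finite_image/finite_finset.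
  exact/finite_image/finite_params.
- move=> phi [[->|[i _ <-]]|[f _ <-]] u; rewrite ?fvars_flift.
  + move=> /(@fvars_fmap _ _ _ (vsum inl (fun u => inr (j u)))) [[//|u0]] h [<-].
    by right; right; exists u0.
  + by move=> [].
  + apply: (@over_pinst L (reduct N') n _ f (vsum c mN) A).
    by move=> [x|x] /=; [right; left|left]; exists x.
- move=> B /finite_setE[m [g ->]] gB.
  suff [f Qf hf] : exists2 f, Q f & forall a : 'I_n -> reduct N',
      (forall i, P (a i)) -> sat (vsum a j) theta ->
      sat (vsum a (vsum c mN)) f -> forall i, holds (U := N') (g i) a.
    have [|||a [Pa ha fa]] := @retraction_witness _ theta f (vsum c mN)
        (vsum d mU) Fth.
    + by move=> [x|x] //=; apply/(Ppart_j hj)/svalP.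
    + by apply: (eqtp_sub (g := vsum id inr) e) => -[].
    + exact: Qf.
    by exists a => _ [i _ <-]; apply: hf.
  elim: m g gB => [|m IH] g gB.
    have [t ht] := exp_true L ('I_n + (V + Mt)).
    exists t => [|a _ _ _ [//]].
    have [//|nt] := qC.2 (pinst t (vsum d mU)).
    have [a] := complete_sat qC nt.
    by rewrite /holds /= => -[]; apply/holds_pinst/ht.
  have [|f Qf hf] := IH (fun i => g (lift ord0 i)).
    by move=> _ [i _ <-]; apply: gB; exists (lift ord0 i).
  suff [f' Qf' hf'] : exists2 f', Q f' & forall a : 'I_n -> reduct N',
      (forall i, P (a i)) -> sat (vsum a j) theta ->
      sat (vsum a (vsum c mN)) f' -> holds (U := N') (g ord0) a.
    exists (fAnd f f'); first exact: (complete_and qC Qf Qf').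
    move=> a Pa ha [h1 h2] i; case: (unliftP ord0 i) => [l|] ->.
      exact: hf.
    exact: hf'.
  have [||hg] := gB (g ord0); first by exists ord0.
    move=> [->|[i _ <-]]; exists f => // a Pa ha _ //.
      by apply/(sat_flift (N := N'))/holds_fext.
    exact: Pa.
  have [f' Qf' <-] := hg.
  exists f' => // a _ _ h.
  by apply/(sat_flift (N := N'))/holds_pinst.
exists a; split.
- move=> i; have : holds (U := N') (fP L (inl i : 'I_n + N')) a.
    by apply: ha; left; right; exists i.
  by [].
- apply/holds_fext.
  by apply/(sat_flift (N := N')); apply: ha; left; left.
- move=> f Qf; apply/holds_pinst.
  by apply/(sat_flift (N := N')); apply: ha; right; exists f.
Qed.

Lemma Morley_sequence : exists c : nat -> 'I_n -> U,
  forall m (f : formula L ('I_n + ('I_m * 'I_n + Mt))),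
    q (pinst f (vsum (fun x : 'I_m * 'I_n => c x.1 x.2) mU)) <->
    sat (vsum (c m) (vsum (fun x : 'I_m * 'I_n => c x.1 x.2) mU)) f.
Proof.
have [Kinf _ hsat _] := hU.
have step (x : nat * (nat -> 'I_n -> U)) : exists b : 'I_n -> U,
    forall f : formula L ('I_n + ('I_x.1 * 'I_n + Mt)),
    q (pinst f (vsum (fun y : 'I_x.1 * 'I_n => x.2 y.1 y.2) mU)) ->
    sat (vsum b (vsum (fun y : 'I_x.1 * 'I_n => x.2 y.1 y.2) mU)) f.
  case: x => m c /=.
  have [|||b hb] := hsat n (M `|` range (fun y : 'I_m * 'I_n => c y.1 y.2))
      (restrict_type (M `|` range (fun y : 'I_m * 'I_n => c y.1 y.2)) q).
  - by apply: (small_setU Kinf) => //; apply/finite_image/finite_finset.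
  - by move=> phi [].
  - by move=> B fB Bq; apply: qC.1 => // phi /Bq[].
  exists b => f qf; apply/holds_pinst; apply: hb; split=> //.
  apply: over_pinst => -[x|x] /=; last by left; apply: svalP.
  by right; exists x.
have /choice[next hnext] := step.
have [phi0 /(complete_sat qC)[a0 _]] := type_inhabited qC.2.
(* [S m] is the sequence after [m] steps, with [a0] at the places not yet filled; entry [i] is final
   from stage [i.+1] on. *)
pose S := fix S m : nat -> 'I_n -> U := if m is m'.+1 then
  fun i => if i == m' then next (m', S m') else S m' i else fun=> a0.
pose c i := S i.+1 i.
have Sc m i : i < m -> S m i = c i.
  elim: m => // m IH; rewrite ltnS leq_eqVlt => /orP[/eqP->//|im].
  by rewrite /= ltn_eqF // IH.
exists c => m f.
have cE : (fun x : 'I_m * 'I_n => c x.1 x.2) = (fun x => S m x.1 x.2).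
  by apply: funext => -[[i im] l] /=; rewrite Sc.
have cm : c m = next (m, S m) by rewrite /c /= eqxx.
have H (g : formula L ('I_n + ('I_m * 'I_n + Mt))) :
    q (pinst g (vsum (fun x : 'I_m * 'I_n => c x.1 x.2) mU)) ->
    sat (vsum (c m) (vsum (fun x : 'I_m * 'I_n => c x.1 x.2) mU)) g.
  rewrite cE cm; exact: (hnext (m, S m)).
split; first exact: H.
move=> h; have [//|/(H (fNot f))] := qC.2 (pinst f (vsum (fun x : 'I_m * 'I_n => c x.1 x.2) mU)).
by case.
Qed.

Lemma retraction_not theta : F q theta -> F q (fNot theta) -> False.
Proof.
move=> F1 F2; have [c hc] := Morley_sequence.
have [l [f [b [thE _]]]] := pformulaE theta.
have thN a : sat (vsum a j) theta <-> sat (vsum a (fun i => j (b i))) f.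
  by rewrite thE -(propext (holds_fext _ _)); apply: (fext_pinst f).
(* A sequence in [N] with the type over [M] of the first [m] terms of [c], on which [theta] follows
   [eta]. Each new point is drawn from [theta] or its negation, as both lie in [F q]. *)
have pattern (eta : nat -> bool) m : exists a : nat -> 'I_n -> reduct N',
    eqtp (vsum (fun x : 'I_m * 'I_n => c x.1 x.2) mU)
         (vsum (fun x : 'I_m * 'I_n => a x.1 x.2) mN) /\
    forall i, i < m -> (forall k, P (a i k)) /\
      (sat (vsum (a i) j) theta <-> eta i).
  elim: m => [|m [a [e ha]]].
    exists (fun i k => j (c i k)); split=> //.
    by apply: (eqtp_sub (g := id) (j_eqtp hj
      (vsum (fun x : 'I_0 * 'I_n => c x.1 x.2) mU))) => -[].
  have [|x|a' [Pa' ha' H]] := retraction_real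
      (theta := if eta m then theta else fNot theta) _ _ e.
  - by case: (eta m).
  - by have [] := ha x.1 (ltn_ord _).
  exists (fun i => if i == m then a' else a i); split.
    have E : eqtp (vsum (c m) (vsum (fun x : 'I_m * 'I_n => c x.1 x.2) mU))
        (vsum a' (vsum (fun x : 'I_m * 'I_n => a x.1 x.2) mN)).
      move=> g; split=> [/hc/H//|h]; apply: contrapT => ng.
      have /H/= : q (pinst (fNot g) (vsum (fun x : 'I_m * 'I_n => c x.1 x.2) mU)) by apply/hc.
      exact.
    apply: (eqtp_sub (g := fun x => match x with
      | inl y => if unlift ord_max y.1 is Some i then inr (inl (i, y.2))
                 else inl y.2
      | inr y => inr (inr y) end) E) => -[[i k]|//] /=.
      by case: (unliftP ord_max i) => [i'|] ->; rewrite ?lift_max.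
    case: (unliftP ord_max i) => [i'|] ->; last by rewrite eqxx.
    by rewrite lift_max ltn_eqF.
  move=> i; rewrite ltnS leq_eqVlt => /orP[/eqP->|im]; last first.
    by rewrite ltn_eqF //; apply: ha.
  rewrite eqxx; split=> //.
  by move: ha'; case: (eta m) => //= h; split=> // /h.
(* In [N'] the parameters of [theta] realise the pattern on [a]; the existence of such parameters
   depends on the type of [a] only, so it holds for [c] in [U]. *)
have shatter (eta : nat -> bool) m : exists y : 'I_l -> U,
    forall i, i < m -> (sat (vsum (c i) y) f <-> eta i).
  have [a [e ha]] := pattern eta m.
  have E : expressible (fun W (v : 'I_m * 'I_n + Mt -> W) =>
      exists y : 'I_l -> W, forall i : 'I_m,
        if eta i then sat (vsum (fun k => v (inl (i, k))) y) f
        else ~ sat (vsum (fun k => v (inl (i, k))) y) f).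
    apply: (exp_ex (R := fun W v y => forall i : 'I_m,
        if eta i then sat (vsum (fun k => v (inl (i, k))) y) f
        else ~ sat (vsum (fun k => v (inl (i, k))) y) f)).
    apply: exp_bigand => i.
    have Es : expressible (fun W (u : 'I_m * 'I_n + Mt + 'I_l -> W) =>
        sat (vsum (fun k => (u \o inl) (inl (i, k))) (u \o inr)) f).
      by apply: (exp_sat (g := vsum (fun k => inl (inl (i, k))) inr)) => ? ? [].
    by case: (eta i) => //; apply: exp_not.
  have [|y hy] := eqtp_expP (eqtp_sym e) E.
    exists (fun i => j (b i)) => i; have [_] := ha i (ltn_ord i).
    rewrite (propext (thN _)) /=; case: (eta i) => [h|h /h//]; exact/h.
  exists y => i im; move: (hy (Ordinal im)) => /=.
  by case: (eta i) => // h; split=> // /h.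
(* A pattern true at [i] alone separates [c i] from any later term. *)
have cinj : injective c.
  suff H i k : i < k -> c i <> c k.
    move=> i k ik; case: (ltngtP i k) => // h; first by case: (H _ _ h).
    by case: (H _ _ h).
  move=> ik ci; have [y hy] := shatter (fun x => x == i) k.+1.
  have h1 := hy k (ltnSn k); have h2 := hy i (ltnW ik).
  by move: h1; rewrite -ci (propext h2) eqxx (gtn_eqF ik) => -[/(_ isT)].
have : finite_set (range c).
  apply: (hNIP (phi := f)) => B Bc.
  have [Kinf _ hsat _] := hU.
  pose fs : formula L ('I_l + 'I_n) := fmap (vsum inr inl) f.
  pose g i := pinst (if `[< B (c i) >] then fs else fNot fs) (c i).
  have hg i y : holds (g i) y <-> (sat (vsum (c i) y) f <-> B (c i)).
    have fsE : sat (vsum y (c i)) fs <-> sat (vsum (c i) y) f.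
      rewrite /fs sat_fmap; have -> // : vsum y (c i) \o vsum inr inl = vsum (c i) y.
      by apply: funext => -[].
    rewrite (propext (holds_pinst _ _ _)); case: asboolP => Bi /=.
      by rewrite (propext fsE); split=> [//|[_]]; apply.
    by rewrite (propext fsE); split=> [h|h /h//]; split=> // /h.
  (* Only countably many parameters occur, so saturation yields one [y] for the whole infinite
     pattern. *)
  have [|||y hy] := hsat l [set u | exists i k, u = c i k] (range g).
  - apply: (countable_small Kinf).
    apply: (@sub_countable _ _ _ [set: nat * 'I_n]); last exact: countableP.
    apply: (card_le_trans _ (card_image_le (fun x => c x.1 x.2) _)).
    by apply: subset_card_le => _ [i [k ->]]; exists (i, k).
  - by move=> _ [i _ <-]; apply: over_pinst => k; exists i, k.
  - move=> B0 /finite_setE[m [h ->]] hB0.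
    have /choice[idx hidx] : forall k, exists i, h k = g i.
      by move=> k; have [|i _ <-] := hB0 (h k); [exists k|exists i].
    have [y hy] := shatter (fun i => `[< B (c i) >]) (\max_(k < m) idx k).+1.
    exists y => _ [k _ <-]; rewrite hidx; apply/hg.
    have /hy -> : idx k < (\max_(k < m) idx k).+1 by rewrite ltnS leq_bigmax.
    by split=> /asboolP.
  by exists y => _ [i _ <-]; apply/hg/hy; exists i.
rewrite (eq_finite_set (inj_card_eq _)); last by move=> x y _ _; apply: cinj.
exact: infinite_nat.
Qed.
Lemma retraction_def theta : F q theta ->
  exists2 chi, inv_ext chi /\ over P chi &
    forall a, (forall i, P (a i)) -> holds chi a -> sat (vsum a j) theta.
Proof.
move=> Fth; have /retractionPn[chi hchi H] : ~ F q (fNot theta).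
  exact: retraction_not.
by exists chi => // a Pa ha; apply: contrapT; apply: H.
Qed.

Lemma retraction_fs : finitely_satisfiable_in M (F q).
Proof.
move=> theta Fth.
have [t ht] := exp_true L ('I_n + void).
have [|||a [Pa ha _]] := @retraction_witness _ theta t (of_void _) (of_void _) Fth.
- by [].
- by apply: (eqtp_sub (g := id) (j_eqtp hj (vsum (of_void U) mU))) => -[].
- have [//|nt] := qC.2 (pinst t (of_void U)).
  have [a] := complete_sat qC nt.
  by rewrite /holds /= => -[]; apply/holds_pinst/ht.
exact: (Ppart_reflect hj (v := id) Pa ha).
Qed.

Lemma retraction_complete : complete_type (F q).
Proof.
apply: complete_typeI; last exact: retraction_total.
- move=> phi psi /retraction_def[chi1 h1 H1] /retraction_def[chi2 h2 H2].
  have [//|/retraction_extP H] := retraction_total (fAnd phi psi).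
  have [r12 P12] := inv_ext_andP h1 h2.
  have [a [Pa /= na [a1 a2]]] := H _ r12 P12.
  by case: na; split; [apply: H1|apply: H2].
- by move=> phi /retraction_fs[a [_ ha]]; exists a.
Qed.

Lemma retraction_over phi : over M phi -> q phi -> F q phi.
Proof.
move=> Mphi qphi; have [//|H] := retraction_total phi.
have [k [f [c [E Mc]]]] := pformulaE phi.
have [|||a [Pa /= na fa]] :=
    @retraction_witness _ (fNot phi) f (fun i => j (c i)) c H.
- by move=> i; apply/(Ppart_j hj); apply/Mphi/Mc.
- by apply: (eqtp_sub (g := id) (j_eqtp hj (vsum c mU))) => -[].
- by rewrite E in qphi.
by case: na; apply/holds_fext; rewrite E; apply/(fext_pinst f).
Qed.

(** The tuple [c] of [N] is replaced by [c1] in [U] with the same type over [M]. As [q] contains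
    [theta] and [f(x, c1)], a point [m] of [M] satisfies both, and [j m] satisfies [f(x, c)]. *)
Lemma retraction_id : finitely_satisfiable_in M q -> F q = q.
Proof.
move=> qfs; apply: esym; apply: (complete_sub_eq qC retraction_complete).
move=> theta qth; apply/retractionP => k f c d Pc e qf.
have [l [g [b [E _]]]] := pformulaE theta.
have eb : eqtp (vsum b mU) (vsum (fun i => j (b i)) mN).
  by apply: (eqtp_sub (g := id) (j_eqtp hj (vsum b mU))) => -[].
have [c1 e1] := real_in_U2 hU hMsmall c eb.
have qf1 : q (inst f c1).
  apply: (invariant_pinst qC qI _ qf).
  exact: (eqtp_trans e (eqtp_sym (eqtp_MW e1))).
have : q (fAnd theta (inst f c1)) by apply: (complete_and qC qth qf1).
move=> /qfs[m [Mm [hth /(holds_pinst f) hf]]].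
exists (fun i => j (m i)); split.
- by move=> i; apply/(Ppart_j hj).
- have := j_eqtp hj (vsum m id) theta => -[/(_ hth) + _].
  by have -> : (fun x => j (vsum m id x)) = vsum (fun i => j (m i)) j
    by apply: funext => -[].
- have e2 : eqtp (vsum m c1) (vsum (fun i => j (m i)) c).
    by apply: (eqtp_sub (g := fun x => match x with
      | inl i => inr (inr (exist _ (m i) (Mm i))) | inr x => inl x end) e1) => -[].
  exact/e2.
Qed.

Lemma sat_subst_graph (W : fostruct L) (u : U -> W) a
    (gam : formula L (('I_n + U) + 'I_n)) (phi : pformula U n) :
  sat (vsum a u) (subst_graph gam phi) <->
  exists y, sat (vsum (vsum a u) y) gam /\ sat (vsum y u) phi.
Proof.
rewrite (propext (sat_exblock _ _)) /=.
have E (y : 'I_n -> W) :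
    vsum (vsum a u) y \o vsum inr (fun u0 => inl (inr u0)) = vsum y u.
  by apply: funext => -[].
by split=> -[y h]; exists y; move: h; rewrite sat_fmap E.
Qed.

End OneType.
(** That the negation of [theta] is not in [F q] is witnessed by one formula [f(x, d)] of [q] and a
    tuple [c] of [N] with the type of [d] over [M], such that [f(x, c)] implies [theta] on [N]. The
    same [c] serves every [q'] containing [f(x, d)]. *)
Lemma retraction_continuous (q : typ U n) theta :
  complete_type q -> invariant M q -> F q theta ->
  exists2 psi, q psi & forall q' : typ U n, complete_type q' -> invariant M q' ->
    q' psi -> F q' theta.
Proof.
move=> qC qI Fth.
have nF : ~ F q (fNot theta) by apply: retraction_not.
suff [k [f [c [d [Pc e qf H]]]]] : exists k (f : formula L ('I_n + 'I_k)) c d,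
    [/\ forall i, P (c i), eqtp (vsum d mU) (vsum c mN), q (inst f d) &
    forall a, (forall i, P (a i)) -> sat (vsum a c) f -> sat (vsum a j) theta].
  exists (inst f d) => // q' q'C q'I q'f.
  have [//|/(retractionP q'C q'I) H'] := retraction_total q'C q'I theta.
  have [a [Pa /= na fa]] := H' k f c d Pc e q'f.
  by case: na; apply: H.
apply: contrapT => nh; apply: nF; apply/(retractionP qC qI) => k f c d Pc e qf.
apply: contrapT => na; apply: nh; exists k, f, c, d; split=> // a Pa fa.
by apply: contrapT => ha; apply: na; exists a.
Qed.

(** [F] commutes with images under [M]-definable functions; [gam] is the graph
    of such a function on the set defined by [D]. *)
Lemma retraction_push (q : typ U n) (gam : formula L (('I_n + U) + 'I_n)) (D : formula L 'I_n)
    (R : forall W : fostruct L, ('I_n + Mt -> W) -> ('I_n -> W) -> Prop) theta :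
  (forall (W : fostruct L) (u : U -> W) a y, sat (vsum (vsum a u) y) gam <->
     R W (vsum a (fun x => u (sval x))) y) ->
  expressible (fun W (w : ('I_n + Mt) + 'I_n -> W) => R W (w \o inl) (w \o inr)) ->
  (forall a, sat a D -> exists y, forall y', R U (vsum a mU) y' <-> y' = y) ->
  complete_type q -> invariant M q -> q (fmap inl D) ->
  complete_type [set phi | q (subst_graph gam phi)] ->
  invariant M [set phi | q (subst_graph gam phi)] ->
  F q (subst_graph gam theta) -> F [set phi | q (subst_graph gam phi)] theta.
Proof.
move=> hR eR funR qC qI qD q'C q'I Fth.
have expR V (h1 : forall W : fostruct L, (V -> W) -> 'I_n + Mt -> W)
    (h2 : forall W : fostruct L, (V -> W) -> 'I_n -> W)
    (g1 : 'I_n + Mt -> V) (g2 : 'I_n -> V) :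
    (forall (W : fostruct L) (v : V -> W) x, h1 W v x = v (g1 x)) ->
    (forall (W : fostruct L) (v : V -> W) x, h2 W v x = v (g2 x)) ->
    expressible (fun W (v : V -> W) => R W (h1 W v) (h2 W v)).
  move=> e1 e2; have [r hr] := eR; exists (fmap (vsum g1 g2) r) => W v.
  rewrite sat_fmap (propext (hr _ _)) (_ : h1 W v = v \o g1); last exact: funext.
  by rewrite (_ : h2 W v = v \o g2); last exact: funext.
have uniqN : forall (a y y' : 'I_n -> reduct N'), sat a D ->
    R (reduct N') (vsum a mN) y -> R (reduct N') (vsum a mN) y' ->
    forall i, y i = y' i.
  pose Q (W : fostruct L) (v : Mt -> W) := forall a : 'I_n -> W,
    forall y : 'I_n -> W, forall y' : 'I_n -> W, sat a D ->
    R W (vsum a v) y -> R W (vsum a v) y' -> forall i, y i = y' i.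
  have EQ : expressible Q.
    apply: (exp_all (k := n)); apply: (exp_all (k := n)); apply: (exp_all (k := n)).
    apply: exp_imp.
      by apply: (exp_sat (g := fun i => inl (inl (inr i)))).
    apply: exp_imp.
      by apply: (expR _ _ _ (vsum (fun i => inl (inl (inr i)))
        (fun i => inl (inl (inl i)))) (fun i => inl (inr i))) => ? ? [].
    apply: exp_imp.
      by apply: (expR _ _ _ (vsum (fun i => inl (inl (inr i)))
        (fun i => inl (inl (inl i)))) inr) => ? ? [].
    by apply: exp_bigand => i; apply: (exp_eq L (inl (inr i)) (inr i)).
  suff : Q U mU by move=> /(eqtp_expP (j_eqtp hj mU) EQ) QN a y y'; apply: QN.
  move=> a y y' Da h h' i; have [z hz] := funR a Da.
  by move/hz: h => ->; move/hz: h' => ->.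
apply/(retractionP q'C q'I) => k f c d Pc e qf.
have [g hg] : expressible (fun W (v : 'I_n + ('I_k + Mt) -> W) =>
    sat (v \o inl) D /\ exists y,
      R W (vsum (v \o inl) (v \o inr \o inr)) y /\
      sat (vsum y (v \o inr \o inl)) f).
  apply: exp_and; first exact: (exp_sat (g := inl)).
  apply: exp_ex; apply: exp_and.
    by apply: (expR _ _ _ (vsum (fun i => inl (inl i))
      (fun x => inl (inr (inr x)))) inr) => ? ? [].
  by apply: (exp_sat (g := vsum inr (fun x => inl (inr (inl x))))) => ? ? [].
have [|||a [Pa /sat_subst_graph [y [/hR hy hyth]] /hg[/= Da [z [hz hzf]]]]] :=
    retraction_witness qC qI (f := g) (c := vsum c mN) (d := vsum d mU) Fth.
- by move=> [x|x] //=; apply/(Ppart_j hj)/svalP.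
- by apply: (eqtp_sub (g := vsum id inr) e) => -[].
- apply: (complete_and qC qD qf) => a.
  rewrite /holds sat_fmap => Da /sat_subst_graph[y [/hR hy hyf]].
  apply/holds_pinst/hg; split=> //=; exists y; split=> //.
  exact/(holds_pinst f).
have zE : z = y by apply: funext => i; exact: uniqN Da hz hy i.
subst z; exists y; split=> //.
(* The value [y] lies in [N]: it solves a formula with parameters from [N], which therefore has a
   solution in [N], and solutions are unique. *)
have [h hh] : expressible (fun W (v : 'I_n + ('I_n + Mt) -> W) =>
    R W (v \o inr) (v \o inl)) by apply: (expR _ _ _ inr inl).
have [l [h0 [g0 hg0]]] := pinst_fin h.
have [||y' [Py' hy']] := Ppart_witness hM hj (phi := h0) (a := y)
    (c := vsum a mN \o g0).
- by move=> i /=; case: (g0 i) => x //=; apply/(Ppart_j hj)/svalP.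
- by apply/hg0/hh.
move: hy' => /hg0/hh hy' i.
by rewrite (uniqN _ _ _ Da hy hy').
Qed.
End Retraction.

(** * Definable groups *)

Lemma fvars_exblock (L : language) k V (phi : formula L (V + 'I_k)) v :
  fvars (exblock phi) v -> fvars phi (inl v).
Proof.
elim: k V phi v => [|k IH] V phi v /=.
  by move=> H; have [[w|[]//] h <-] := fvars_fmap H.
move=> H; have [[w|i] h /=] := fvars_fmap (IH _ _ _ H); first by case=> <-.
by case: unliftP.
Qed.

Section GroupLaw.
Variables (L : language) (U : fostruct L) (n : nat) (G : defgroup U n).

Lemma gop_ex : exists op : ('I_n -> U) * ('I_n -> U) -> 'I_n -> U,
  forall x, ginG G x.1 -> ginG G x.2 ->
    ginG G (op x) /\ forall c, gprod G x.1 x.2 c <-> c = op x.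
Proof.
suff /choice[op h] : forall x, exists y, ginG G x.1 -> ginG G x.2 ->
    ginG G y /\ forall c, gprod G x.1 x.2 c <-> c = y by exists op.
move=> -[a b] /=.
have [[Ga Gb]|nG] := pselect (ginG G a /\ ginG G b).
  by have [c Gc hc] := gprod_fun Ga Gb; exists c.
by exists a => Ga Gb; case: nG.
Qed.

Definition gop a b : 'I_n -> U := projT1 (cid gop_ex) (a, b).

Lemma gopG a b : ginG G a -> ginG G b -> ginG G (gop a b).
Proof. by move=> Ga Gb; have [] := projT2 (cid gop_ex) (a, b) Ga Gb. Qed.

Lemma gopP a b c : ginG G a -> ginG G b -> gprod G a b c <-> c = gop a b.
Proof. by move=> Ga Gb; have [_] := projT2 (cid gop_ex) (a, b) Ga Gb; apply. Qed.

Lemma gopA a b c : ginG G a -> ginG G b -> ginG G c ->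
  gop a (gop b c) = gop (gop a b) c.
Proof.
move=> Ga Gb Gc; have Gab := gopG Ga Gb; have Gbc := gopG Gb Gc.
by apply/esym/gopP => //; apply: (gprodA Ga Gb Gc); apply/gopP.
Qed.

Lemma gone_ex : exists e, ginG G e /\ forall a, ginG G a ->
  [/\ gop e a = a, gop a e = a &
      exists2 a', ginG G a' & gop a a' = e /\ gop a' a = e].
Proof.
have [e Ge he] := gunitV G; exists e; split=> // a Ga.
have [h1 h2 [a' Ga' [h3 h4]]] := he a Ga.
split; [exact/esym/gopP|exact/esym/gopP|exists a' => //].
by split; exact/esym/gopP.
Qed.

Definition gone : 'I_n -> U := projT1 (cid gone_ex).

Lemma goneG : ginG G gone.
Proof. by have [] := projT2 (cid gone_ex). Qed.

Lemma gop1l a : ginG G a -> gop gone a = a.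
Proof. by have [_ h] := projT2 (cid gone_ex) => /h[]. Qed.

Lemma gop1r a : ginG G a -> gop a gone = a.
Proof. by have [_ h] := projT2 (cid gone_ex) => /h[]. Qed.

Lemma ginv_ex : exists i : ('I_n -> U) -> 'I_n -> U, forall a, ginG G a ->
  [/\ ginG G (i a), gop a (i a) = gone & gop (i a) a = gone].
Proof.
suff /choice[i h] : forall a, exists y, ginG G a ->
    [/\ ginG G y, gop a y = gone & gop y a = gone] by exists i.
move=> a; have [Ga|nG] := pselect (ginG G a); last by exists a.
have [_ h] := projT2 (cid gone_ex); have [_ _ [b Gb [h1 h2]]] := h a Ga.
by exists b.
Qed.

Definition ginv : ('I_n -> U) -> 'I_n -> U := projT1 (cid ginv_ex).

Lemma ginvG a : ginG G a -> ginG G (ginv a).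
Proof. by move=> /(projT2 (cid ginv_ex))[]. Qed.

Lemma gopV a : ginG G a -> gop a (ginv a) = gone.
Proof. by move=> /(projT2 (cid ginv_ex))[]. Qed.

Lemma gopVl a : ginG G a -> gop (ginv a) a = gone.
Proof. by move=> /(projT2 (cid ginv_ex))[]. Qed.

Lemma gopK a b : ginG G a -> ginG G b -> gop (gop a b) (ginv b) = a.
Proof. by move=> Ga Gb; rewrite -gopA ?gopV ?gop1r //; apply: ginvG. Qed.

Lemma gopVK a b : ginG G a -> ginG G b -> gop (gop a (ginv b)) b = a.
Proof. by move=> Ga Gb; rewrite -gopA ?gopVl ?gop1r //; apply: ginvG. Qed.

Lemma gopKl a b : ginG G a -> ginG G b -> gop (ginv a) (gop a b) = b.
Proof. by move=> Ga Gb; rewrite gopA ?gopVl ?gop1l //; apply: ginvG. Qed.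

Lemma gop_inv_uniq a b : ginG G a -> ginG G b -> gop a b = gone -> b = ginv a.
Proof.
move=> Ga Gb ab; rewrite -(gopKl Ga Gb) ab gop1r //; exact: ginvG.
Qed.

Lemma ginvK a : ginG G a -> ginv (ginv a) = a.
Proof.
by move=> Ga; apply/esym/gop_inv_uniq => //; [apply: ginvG|apply: gopVl].
Qed.

Lemma ginvM a b : ginG G a -> ginG G b ->
  ginv (gop a b) = gop (ginv b) (ginv a).
Proof.
move=> Ga Gb; have Ga' := ginvG Ga; have Gb' := ginvG Gb.
apply/esym/gop_inv_uniq; [exact: gopG|exact: gopG|].
by rewrite gopA ?gopK ?gopV //; apply: gopG.
Qed.

(** The formula for the inverse describes the neutral element as an idempotent, so as to use no
    parameters. *)
Lemma gop_idem z : ginG G z -> gop z z = z -> z = gone.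
Proof. by move=> Gz zz; rewrite -(gopVl Gz) -{3}zz gopKl. Qed.

Section Substitutions.
Variables (W : fostruct L) (u : U -> W).

Lemma sat_mulr_graph c (a y : 'I_n -> W) :
  sat (vsum (vsum a u) y) (fmap (vsum (vsum (fun i => inl (inl i))
    (fun i => inl (inr (c i)))) inr) (gmul G) : formula L (('I_n + U) + 'I_n)) <->
  sat (vsum (vsum a (fun i => u (c i))) y) (gmul G).
Proof.
rewrite sat_fmap (_ : _ \o _ = vsum (vsum a (fun i => u (c i))) y) //.
by apply: funext => -[[]|].
Qed.

Lemma sat_mull_graph c (a y : 'I_n -> W) :
  sat (vsum (vsum a u) y) (fmap (vsum (vsum (fun i => inl (inr (c i)))
    (fun i => inl (inl i))) inr) (gmul G) : formula L (('I_n + U) + 'I_n)) <->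
  sat (vsum (vsum (fun i => u (c i)) a) y) (gmul G).
Proof.
rewrite sat_fmap (_ : _ \o _ = vsum (vsum (fun i => u (c i)) a) y) //.
by apply: funext => -[[]|].
Qed.

End Substitutions.

Definition inv_graph : formula L (('I_n + U) + 'I_n) :=
  let x i : (('I_n + U) + 'I_n) + 'I_n := inl (inl (inl i)) in
  let y i : (('I_n + U) + 'I_n) + 'I_n := inl (inr i) in
  let z i : (('I_n + U) + 'I_n) + 'I_n := inr i in
  fAnd (fmap inr (gdom G))
    (exblock (fAnd (fmap (vsum (vsum x y) z) (gmul G))
                   (fmap (vsum (vsum z z) z) (gmul G)))).

Definition inv_rel (W : fostruct L) (a y : 'I_n -> W) : Prop :=
  sat y (gdom G) /\ exists z : 'I_n -> W,
    sat (vsum (vsum a y) z) (gmul G) /\ sat (vsum (vsum z z) z) (gmul G).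

Lemma sat_inv_graph (W : fostruct L) (u : U -> W) (a y : 'I_n -> W) :
  sat (vsum (vsum a u) y) inv_graph <-> inv_rel a y.
Proof.
rewrite /inv_graph /= sat_fmap (propext (sat_exblock _ _)) /=.
rewrite (_ : _ \o inr = y) //.
apply: and_iff_compat_l; split=> -[z h]; exists z; move: h; rewrite !sat_fmap.
- rewrite (_ : _ \o _ = vsum (vsum a y) z); last by apply: funext => -[[]|].
  by rewrite (_ : _ \o _ = vsum (vsum z z) z); last by apply: funext => -[[]|].
- rewrite (_ : _ \o vsum (vsum (fun i => inl (inl (inl i))) _) _ =
    vsum (vsum a y) z); last by apply: funext => -[[]|].
  by rewrite (_ : _ \o _ = vsum (vsum z z) z); last by apply: funext => -[[]|].
Qed.

Lemma inv_relP (a y : 'I_n -> U) : ginG G a -> inv_rel a y <-> y = ginv a.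
Proof.
move=> Ga; split=> [[Gy [z [/(gopP _ Ga Gy) zE]]]|->].
  have Gz : ginG G z by rewrite zE; apply: gopG.
  move=> /(gopP _ Gz Gz)/esym/(gop_idem Gz) z1.
  by apply: gop_inv_uniq => //; rewrite -zE.
have Ga' := ginvG Ga.
split=> //; exists gone; split; first by apply/gopP; rewrite ?gopV.
by apply/gopP; rewrite ?gop1l //; apply: goneG.
Qed.

Lemma holds_fmulr c phi a : ginG G c -> ginG G a ->
  holds (fmulr G c phi) a <-> holds phi (gop a c).
Proof.
move=> Gc Ga; rewrite /holds (propext (sat_subst_graph _ _ _ _)).
split=> [[y [/sat_mulr_graph/(gopP _ Ga Gc)->]]//|h].
by exists (gop a c); split=> //; apply/sat_mulr_graph/gopP.
Qed.

Lemma holds_fmull c phi a : ginG G c -> ginG G a ->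
  holds (fmull G c phi) a <-> holds phi (gop c a).
Proof.
move=> Gc Ga; rewrite /holds (propext (sat_subst_graph _ _ _ _)).
split=> [[y [/sat_mull_graph/(gopP _ Gc Ga)->]]//|h].
by exists (gop c a); split=> //; apply/sat_mull_graph/gopP.
Qed.

Lemma holds_finv phi a : ginG G a ->
  holds (finv_subst G phi) a <-> holds phi (ginv a).
Proof.
move=> Ga; rewrite /holds (propext (sat_subst_graph _ _ inv_graph _)).
split=> [[y [/sat_inv_graph/(inv_relP _ Ga)->]]//|h].
by exists (ginv a); split=> //; apply/sat_inv_graph/inv_relP.
Qed.

Lemma over_subst_graph gam (phi : pformula U n) (A : set U) :
  (forall u, fvars gam (inl (inr u)) -> A u) -> over A phi ->
  over A (subst_graph gam phi).
Proof.
move=> hg hphi u H; have [/hg//|/= {}H] := fvars_exblock H.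
by have [[i|w] h //= [<-]] := fvars_fmap H; apply: hphi.
Qed.

Lemma over_fmulr c phi (A : set U) : (forall i, A (c i)) -> over A phi ->
  over A (fmulr G c phi).
Proof.
move=> Ac; apply: over_subst_graph => u H.
by have [[[i|i]|i] _ //= [<-]] := fvars_fmap H.
Qed.

Lemma over_fmull c phi (A : set U) : (forall i, A (c i)) -> over A phi ->
  over A (fmull G c phi).
Proof.
move=> Ac; apply: over_subst_graph => u H.
by have [[[i|i]|i] _ //= [<-]] := fvars_fmap H.
Qed.

Lemma over_finv phi (A : set U) : over A phi -> over A (finv_subst G phi).
Proof.
apply: over_subst_graph => u /= [H|H]; first by have [] := fvars_fmap H.
by have [{}H|{}H] := fvars_exblock H; have [[[i|i]|i] _ //] := fvars_fmap H.
Qed.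

Lemma over_gdom (A : set U) : over A (fmap inl (gdom G) : pformula U n).
Proof. by move=> u H; have [] := fvars_fmap H. Qed.

Lemma holds_gdom a : holds (fmap inl (gdom G) : pformula U n) a <-> ginG G a.
Proof. by rewrite /holds sat_fmap. Qed.

Implicit Types (p q : typ U n).

Lemma SG_and p phi psi chi : SG G p -> p phi -> p psi ->
  (forall a, ginG G a -> holds phi a -> holds psi a -> holds chi a) -> p chi.
Proof.
move=> [pC pG] hphi hpsi h.
have : p (fAnd (fmap inl (gdom G)) phi) by apply: (complete_and pC pG hphi).
move=> h1; apply: (complete_and pC h1 hpsi) => a [/holds_gdom Ga h2] h3.
exact: h.
Qed.

Lemma SG_mp p phi psi : SG G p -> p phi ->
  (forall a, ginG G a -> holds phi a -> holds psi a) -> p psi.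
Proof. by move=> pG h hh; apply: (SG_and pG h h) => a Ga /(hh a Ga). Qed.

Lemma SG_iff p phi psi : SG G p ->
  (forall a, ginG G a -> (holds phi a <-> holds psi a)) -> p phi <-> p psi.
Proof. by move=> pG h; split=> hp; apply: (SG_mp pG hp) => a /h[]. Qed.

Lemma SG_sat p phi : SG G p -> p phi -> exists2 a, ginG G a & holds phi a.
Proof.
move=> pG h; have : p (fAnd (fmap inl (gdom G)) phi).
  by apply: (SG_and pG h h) => a Ga ha _; split=> //; apply/holds_gdom.
by move=> /(complete_sat pG.1)[a [/holds_gdom Ga ha]]; exists a.
Qed.

Lemma SG_push p (T : pformula U n -> pformula U n)
    (f : ('I_n -> U) -> 'I_n -> U) :
  (forall a, ginG G a -> ginG G (f a)) ->
  (forall phi a, ginG G a -> holds (T phi) a <-> holds phi (f a)) ->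
  SG G p -> SG G [set phi | p (T phi)].
Proof.
move=> fG hT pG; split.
  apply: complete_typeI => [phi psi h1 h2|phi h|phi] /=.
  - by apply: (SG_and pG h1 h2) => a Ga /hT h3 /hT h4; apply/hT => //; split;
       [apply: h3|apply: h4].
  - by have [a Ga /hT ha] := SG_sat pG h; exists (f a); apply: ha.
  - have [h|h] := pG.1.2 (T phi); [by left|right].
    by apply: (SG_mp pG h) => a Ga nh; apply/hT => // /hT h'; apply: nh; apply: h'.
apply: (SG_mp pG pG.2) => a Ga _; apply/hT => //; apply/holds_gdom; exact: fG.
Qed.

Lemma SG_mulr p c : SG G p -> ginG G c -> SG G (typ_mulr G p c).
Proof.
move=> pG Gc; apply: (SG_push (f := gop^~ c)) => // [a Ga|phi a Ga].
  exact: gopG.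
exact: holds_fmulr.
Qed.

Lemma SG_inv p : SG G p -> SG G (typ_inv G p).
Proof.
move=> pG; apply: (SG_push (f := ginv)) => // [a Ga|phi a Ga].
  exact: ginvG.
exact: holds_finv.
Qed.

Lemma typ_invK p : SG G p -> typ_inv G (typ_inv G p) = p.
Proof.
move=> pG; apply/seteqP; suff H phi : typ_inv G (typ_inv G p) phi <-> p phi.
  by split=> phi /H.
apply: (SG_iff pG) => a Ga; have Ga' := ginvG Ga.
by rewrite (propext (holds_finv _ Ga)) (propext (holds_finv _ Ga')) ginvK.
Qed.

Lemma typ_mulrM p c d : SG G p -> ginG G c -> ginG G d ->
  typ_mulr G (typ_mulr G p c) d = typ_mulr G p (gop c d).
Proof.
move=> pG Gc Gd; have Gcd := gopG Gc Gd; apply/seteqP.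
suff H phi : typ_mulr G (typ_mulr G p c) d phi <-> typ_mulr G p (gop c d) phi.
  by split=> phi /H.
apply: (SG_iff pG) => a Ga; have Gac := gopG Ga Gc.
rewrite (propext (holds_fmulr _ Gc Ga)) (propext (holds_fmulr _ Gd Gac)).
by rewrite (propext (holds_fmulr _ Gcd Ga)) gopA.
Qed.

Lemma typ_mulr1 p : SG G p -> typ_mulr G p gone = p.
Proof.
move=> pG; apply/seteqP; suff H phi : typ_mulr G p gone phi <-> p phi.
  by split=> phi /H.
apply: (SG_iff pG) => a Ga.
by rewrite (propext (holds_fmulr _ goneG Ga)) gop1r.
Qed.

Lemma typ_mull_inv p c : SG G p -> ginG G c ->
  typ_mull G c (typ_inv G p) = typ_inv G (typ_mulr G p (ginv c)).
Proof.
move=> pG Gc; have Gc' := ginvG Gc; apply/seteqP.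
suff H phi : typ_mull G c (typ_inv G p) phi <->
    typ_inv G (typ_mulr G p (ginv c)) phi by split=> phi /H.
apply: (SG_iff pG) => a Ga; have Ga' := ginvG Ga; have Gac := gopG Ga Gc'.
rewrite (propext (holds_finv _ Ga)) (propext (holds_fmull _ Gc Ga')).
rewrite (propext (holds_fmulr _ Gc' Ga)) (propext (holds_finv _ Gac)).
by rewrite ginvM // ginvK.
Qed.

Lemma typ_orbl_inv p : SG G p ->
  typ_orbl G (ginG G) (typ_inv G p) = typ_inv G @` typ_orbr G p (ginG G).
Proof.
move=> pG; apply/seteqP; split=> [_ [c Gc <-]|_ [_ [c Gc <-] <-]].
  rewrite typ_mull_inv //; exists (typ_mulr G p (ginv c)) => //.
  by exists (ginv c) => //; apply: ginvG.
exists (ginv c); first exact: ginvG.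
by rewrite typ_mull_inv ?ginvK //; apply: ginvG.
Qed.

End GroupLaw.

(** * The Newelski product *)

Section Newelski.
Variables (L : language) (K : Type) (U : fostruct L) (hU : monster K U).
Variables (M : set U) (hM : elementary_substruct M).
Hypothesis hMsmall : card_lt M [set: K].
Variables (n : nat) (G : defgroup U n).
Implicit Types (p q s : typ U n).

Local Notation Mt := {x : U | M x}.
Local Notation mU := (sval : Mt -> U).
Local Notation mul := (newelski G M).

(** Otherwise [s] contains [phi(x, b)] and the negation of [phi(x, c)]; a point of [M] satisfying
    both would tell [b] from [c] over [M]. *)
Lemma fs_invariant s : complete_type s -> finitely_satisfiable_in M s ->
  invariant M s.
Proof.
move=> sC sfs.
suff H k (phi : formula L ('I_n + 'I_k)) b c : same_type M b c ->
    s (inst phi b) -> s (inst phi c).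
  move=> k phi b c bc; split; first exact: H.
  by apply: H => psi /bc[h1 h2].
move=> /same_typeP bc hb; apply: contrapT => /(complete_not _ sC) hc.
have /sfs[a [Ma [/(holds_pinst phi) h1 h2]]] :
  s (fAnd (inst phi b) (fNot (inst phi c))) by apply: (complete_and sC hb hc).
apply: h2; apply/(holds_pinst phi).
have e : eqtp (vsum a b) (vsum a c).
  by apply: (eqtp_sub (g := vsum (fun i => inr (exist _ (a i) (Ma i))) inl)
    bc) => -[].
exact/e.
Qed.

Lemma Sfs_Sinv s : Sfs G M s -> Sinv G M s.
Proof. by move=> [sG sfs]; split=> //; apply: fs_invariant => //; case: sG. Qed.

Lemma realize_type q (B : set U) : SG G q -> finite_set B ->
  exists2 b, ginG G b & realizes b (restrict_type (M `|` B) q).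
Proof.
move=> qG fB; have [Kinf _ hsat _] := hU.
have [|||b hb] := hsat n (M `|` B) (restrict_type (M `|` B) q).
- exact: small_setU.
- by move=> phi [].
- by move=> C fC Cq; apply: qG.1.1 => // phi /Cq[].
exists b => //; apply/holds_gdom; apply: hb; split; first by case: qG.
exact: over_gdom.
Qed.

Lemma realizes_sub b q (A B : set U) : A `<=` B ->
  realizes b (restrict_type B q) -> realizes b (restrict_type A q).
Proof. by move=> AB h phi [qphi Aphi]; apply: h; split=> // u /Aphi/AB. Qed.

Lemma realizes_iff b q (A : set U) phi : complete_type q ->
  realizes b (restrict_type A q) -> over A phi -> q phi <-> holds phi b.
Proof.
move=> qC h Aphi; split=> [qphi|hb]; first exact: h.
have [//|nq] := qC.2 phi; have nb : ~ holds phi b by apply: (h (fNot phi)).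
by case: nb.
Qed.

Lemma realizes_G b q (A : set U) : SG G q -> realizes b (restrict_type A q) ->
  ginG G b.
Proof.
move=> qG h; apply/holds_gdom; apply: h; split; first by case: qG.
exact: over_gdom.
Qed.

Lemma realizes_same V (v : V -> U) b b' q (A : set U) : complete_type q ->
  (forall x, A (v x)) -> realizes b (restrict_type A q) ->
  realizes b' (restrict_type A q) -> eqtp (vsum b v) (vsum b' v).
Proof.
move=> qC Av h h' f; have Af : over A (pinst f v) by apply: over_pinst.
rewrite -!(propext (holds_pinst f v _)).
by rewrite -(propext (realizes_iff qC h Af)) -(propext (realizes_iff qC h' Af)).
Qed.

Lemma exp_mulr k (f : formula L ('I_n + 'I_k)) :
  expressible (fun W (v : 'I_n + (('I_n + 'I_k) + Mt) -> W) =>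
    exists y, sat (vsum (vsum (v \o inl) (v \o inr \o inl \o inl)) y) (gmul G) /\
      sat (vsum y (v \o inr \o inl \o inr)) f).
Proof.
apply: exp_ex; apply: exp_and.
  by apply: (exp_sat (g := vsum (vsum (fun i => inl (inl i))
    (fun i => inl (inr (inl (inl i))))) inr)) => ? ? [[]|].
by apply: (exp_sat (g := vsum inr (fun i => inl (inr (inl (inr i))))))
  => ? ? [].
Qed.

Lemma invariant_mulr k (f : formula L ('I_n + 'I_k)) q (b c : 'I_n -> U)
    (d e : 'I_k -> U) : complete_type q -> invariant M q ->
  eqtp (vsum (vsum b d) mU) (vsum (vsum c e) mU) ->
  q (fmulr G b (inst f d)) -> q (fmulr G c (inst f e)).
Proof.
move=> qC qI bc; apply: (invariant_expP qC qI bc (exp_mulr f)) => a.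
  move=> /sat_subst_graph[y [/sat_mulr_graph h1 /(holds_pinst f) h2]].
  by exists y.
move=> /= [y [h1 h2]]; apply/sat_subst_graph; exists y.
by split; [apply/sat_mulr_graph|apply/(holds_pinst f)].
Qed.

(** By invariance [p] sees only the type over [M] of [b] together with the parameters of [phi].
    Hence one [b] over a large [A] serves several formulas at once. *)
Lemma newelskiE p q (A : set U) b phi : Sinv G M p -> SG G q ->
  M `<=` A -> over A phi -> realizes b (restrict_type A q) ->
  mul p q phi <-> p (fmulr G b phi).
Proof.
move=> [[pC pG] pI] qG MA Aphi hb.
have MA' : M `|` params phi `<=` A by move=> u [/MA//|/Aphi].
split=> [[b' hb' h]|h]; last by exists b => //; apply: realizes_sub MA' hb.
have [k [f [d [E Ad]]]] := pformulaE phi; rewrite E in h *.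
apply: (invariant_mulr pC pI _ h).
have e : eqtp (vsum b' (vsum d mU)) (vsum b (vsum d mU)).
  apply: (realizes_same qG.1 _ hb' (realizes_sub MA' hb)) => -[i|x] /=.
    by right; apply: Ad.
  by left; apply: svalP.
by apply: (eqtp_sub (g := vsum (vsum inl (fun i => inr (inl i)))
  (fun x => inr (inr x))) e) => -[[]|].
Qed.

Lemma newelski_real p q phi (B : set U) : Sinv G M p -> SG G q ->
  finite_set B -> over (M `|` B) phi ->
  exists b, [/\ ginG G b, realizes b (restrict_type (M `|` B) q) &
    mul p q phi <-> p (fmulr G b phi)].
Proof.
move=> pI qG fB hphi; have [b Gb hb] := realize_type qG fB.
by exists b; split=> //; apply: newelskiE hb => // x; left.
Qed.

Lemma SG_newelski p q : Sinv G M p -> SG G q -> SG G (mul p q).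
Proof.
move=> pI qG; have pG : SG G p by case: pI.
have over_par (phi : pformula U n) : over (M `|` params phi) phi.
  by move=> u hu; right.
split; last first.
  have [b [Gb _ ->]] := newelski_real pI qG (@finite_set0 U)
    (@over_gdom _ _ _ G (M `|` set0)).
  apply: (SG_mp pG pG.2) => a Ga _; apply/holds_fmulr => //.
  by apply/holds_gdom; apply: gopG.
apply: complete_typeI => [phi psi h1 h2|phi|phi].
- have [b Gb hb] := realize_type qG (finite_params (fAnd phi psi)).
  have E chi : over (M `|` params (fAnd phi psi)) chi ->
      mul p q chi <-> p (fmulr G b chi).
    by move=> hchi; apply: newelskiE hb => // x; left.
  apply/E => //; move: h1 h2 => /E h1 /E h2.
  apply: (SG_and pG (h1 _) (h2 _)).
  + by move=> u hu; right; left.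
  + by move=> u hu; right; right.
  + by move=> a Ga /holds_fmulr h3 /holds_fmulr h4; apply/holds_fmulr => //;
       split; [apply: h3|apply: h4].
- have [b [Gb _ ->]] := newelski_real pI qG (finite_params phi) (over_par phi).
  by move=> /(SG_sat pG)[a Ga /holds_fmulr h]; exists (gop G a b); apply: h.
- have [b [Gb hb E]] := newelski_real pI qG (finite_params phi) (over_par phi).
  have [h|h] := pG.1.2 (fmulr G b phi); [left; exact/E|right].
  apply/(newelskiE (A := M `|` params phi) pI qG _ _ hb).
  + by move=> x; left.
  + exact: over_par.
  apply: (SG_mp pG h) => a Ga nh; apply/holds_fmulr => // h'.
  by apply: nh; apply/holds_fmulr.
Qed.

Lemma elementary_witness_var V k (phi : formula L ('I_k + V)) (a : 'I_k -> U)
    (c : V -> U) : (forall x, M (c x)) -> sat (vsum a c) phi ->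
  exists a', (forall i, M (a' i)) /\ sat (vsum a' c) phi.
Proof.
move=> Mc; have [l [phi0 [g hg]]] := pinst_fin phi.
move=> /hg/(elementary_witness hM)[i|a' [Ma' h]]; first exact: Mc.
by exists a'; split=> //; apply/hg.
Qed.

Lemma gpoints_gop a b : gpoints G M a -> gpoints G M b ->
  gpoints G M (gop G a b).
Proof.
move=> [Ga Ma] [Gb Mb]; split; first exact: gopG.
pose phi : formula L ('I_n + ('I_n + 'I_n)) := fmap (vsum inr inl) (gmul G).
have hphi c : sat (vsum c (vsum a b)) phi <-> c = gop G a b.
  rewrite -(propext (gopP _ Ga Gb)) /phi sat_fmap.
  by rewrite (_ : _ \o _ = vsum (vsum a b) c) //; apply: funext => -[].
have [||c [Mc /hphi <-]] := elementary_witness_var (phi := phi)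
  (a := gop G a b) (c := vsum a b) => //; first by case.
exact/hphi.
Qed.

Lemma gpoints_ginv a : gpoints G M a -> gpoints G M (ginv G a).
Proof.
move=> [Ga Ma]; split; first exact: ginvG.
have [phi hphi] : expressible (fun W (v : 'I_n + 'I_n -> W) =>
    inv_rel G (v \o inr) (v \o inl)).
  apply: exp_and; first exact: (exp_sat (g := inl)).
  apply: exp_ex; apply: exp_and.
    by apply: (exp_sat (g := vsum (vsum (fun i => inl (inr i))
      (fun i => inl (inl i))) inr)) => ? ? [[]|].
  by apply: (exp_sat (g := vsum (vsum inr inr) inr)) => ? ? [[]|].
have [||b [Mb /hphi/(inv_relP _ Ga) <-]] := elementary_witness_var (phi := phi)
  (a := ginv G a) (c := a) => //.
exact/hphi/inv_relP.
Qed.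

Lemma SG_gpoint p phi : Sfs G M p -> p phi ->
  exists2 m, gpoints G M m & holds phi m.
Proof.
move=> [pG pfs] h; have /pfs[m [Mm [/holds_gdom Gm hm]]] :
    p (fAnd (fmap inl (gdom G)) phi).
  by apply: (SG_and pG h h) => a Ga ha _; split=> //; apply/holds_gdom.
by exists m.
Qed.

(** Points of [M] are found one factor at a time: [m] for [p] with [b] fixed; then [phi(m * x)]
    belongs to [q] and gives [m']. *)
Lemma Sfs_newelski p q : Sfs G M p -> Sfs G M q -> Sfs G M (mul p q).
Proof.
move=> pF qF; have pI := Sfs_Sinv pF; have qG : SG G q by case: qF.
split; first exact: SG_newelski.
move=> phi.
have over_phi : over (M `|` params phi) phi by move=> u hu; right.
have [b [Gb hb ->]] := newelski_real pI qG (finite_params phi) over_phi => h.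
have [m [Gm Mm] /holds_fmulr hm] := SG_gpoint pF h.
have : q (fmull G m phi).
  apply/(realizes_iff qG.1 hb); last by apply/holds_fmull => //; apply: hm.
  by apply: over_fmull => // i; left.
move=> /(SG_gpoint qF)[m' [Gm' Mm'] /holds_fmull hm'].
have [Gmm Mmm] := gpoints_gop (conj Gm Mm) (conj Gm' Mm').
by exists (gop G m m'); split=> //; apply: hm'.
Qed.

Lemma Sfs_inv p : Sfs G M p -> Sfs G M (typ_inv G p).
Proof.
move=> pF; split=> [|phi]; first by apply: SG_inv; case: pF.
move=> /(SG_gpoint pF)[m GMm /holds_finv hm].
have [Gm' Mm'] := gpoints_ginv GMm.
by exists (ginv G m); split=> //; apply: hm; case: GMm.
Qed.

(** If [c] realises [s], and [b] realises [q] over a set containing [c], then [b * c] realises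
    [q * s], and both sides say [phi(x * b * c)]. Finite satisfiability makes [p * q] invariant
    again. *)
Lemma newelskiA p q s : Sfs G M p -> Sfs G M q -> Sfs G M s ->
  mul (mul p q) s = mul p (mul q s).
Proof.
move=> pF qF sF; have pI := Sfs_Sinv pF; have qI := Sfs_Sinv qF.
have pqI := Sfs_Sinv (Sfs_newelski pF qF).
have [pG _] := pF; have [qG _] := qF; have [sG _] := sF.
have qsG := SG_newelski qI sG.
apply/seteqP; suff H phi : mul (mul p q) s phi <-> mul p (mul q s) phi.
  by split=> phi /H.
have over_phi : over (M `|` params phi) phi by move=> u hu; right.
have [c Gc hc] := realize_type sG (finite_params phi).
have [|b Gb hb] := realize_type qG (B := params phi `|` range c).
  rewrite finite_setU; split; first exact: finite_params.
  exact/finite_image/finite_finset.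
have subA : M `|` params phi `<=` M `|` (params phi `|` range c).
  by move=> u [|]; [left|right; left].
have over_c psi : over (M `|` params phi) psi ->
    over (M `|` (params phi `|` range c)) (fmulr G c psi).
  move=> hpsi; apply: over_fmulr => [i|u /hpsi/subA//].
  by right; right; exists i.
rewrite (propext (newelskiE pqI sG _ over_phi hc)); last by move=> x; left.
rewrite (propext (newelskiE pI qG _ (over_c _ over_phi) hb)); last by move=> x; left.
have hbc : realizes (gop G b c) (restrict_type (M `|` params phi) (mul q s)).
  move=> psi [h hpsi].
  apply/holds_fmulr => //; apply: hb; split; last exact: over_c.
  by apply/(newelskiE qI sG _ hpsi hc) => // x; left.
rewrite (propext (newelskiE pI qsG _ over_phi hbc)); last by move=> x; left.
apply: (SG_iff pG) => a Ga; have Gab := gopG Ga Gb; have Gbc := gopG Gb Gc.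
rewrite (propext (holds_fmulr _ Gb Ga)) (propext (holds_fmulr _ Gc Gab)).
by rewrite (propext (holds_fmulr _ Gbc Ga)) gopA.
Qed.

Lemma Sinv_inv q : Sinv G M q -> Sinv G M (typ_inv G q).
Proof.
move=> [qG qI]; split; first exact: SG_inv.
suff H k (f : formula L ('I_n + 'I_k)) b c : same_type M b c ->
    q (finv_subst G (inst f b)) -> q (finv_subst G (inst f c)).
  move=> k phi b c bc; split; first exact: H.
  by apply: H => psi /bc[h1 h2].
move=> /same_typeP bc.
pose R (W : fostruct L) (v : 'I_n + ('I_k + Mt) -> W) := exists y,
  inv_rel G (v \o inl) y /\ sat (vsum y (v \o inr \o inl)) f.
apply: (invariant_expP qG.1 qI bc (R := R)).
- apply: exp_ex; apply: exp_and.
    apply: exp_and; first exact: (exp_sat (g := inr)).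
    apply: exp_ex; apply: exp_and.
      by apply: (exp_sat (g := vsum (vsum (fun i => inl (inl (inl i)))
        (fun i => inl (inr i))) inr)) => ? ? [[]|].
    by apply: (exp_sat (g := vsum (vsum inr inr) inr)) => ? ? [[]|].
  by apply: (exp_sat (g := vsum inr (fun i => inl (inr (inl i))))) => ? ? [].
- move=> a /sat_subst_graph[y [/sat_inv_graph h1 /(holds_pinst f) h2]].
  by exists y.
- move=> a /= [y [h1 h2]]; apply/sat_subst_graph; exists y.
  by split; [apply/sat_inv_graph|apply/(holds_pinst f)].
Qed.

(** * The congruence of a strong right f-generic type *)

Section Generic.
Variable p : typ U n.
Hypotheses (hp : Sinv G M p) (hfg : strong_right_fgeneric G M p).

Let pG : SG G p. Proof. by case: hp. Qed.

Lemma Sinv_mulr g : ginG G g -> Sinv G M (typ_mulr G p g).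
Proof. by move=> Gg; split; [exact: SG_mulr|exact: hfg]. Qed.

(* Move the parameters of a formula of [q g] along with [g], then move them back
   using the invariance of [q h]. *)
Lemma typ_mulr_same q g h : Sinv G M q -> ginG G g -> ginG G h ->
  invariant M (typ_mulr G q h) -> eqtp (vsum g mU) (vsum h mU) ->
  typ_mulr G q g = typ_mulr G q h.
Proof.
move=> [qG qI] Gg Gh hI gh.
have hG := SG_mulr qG Gh.
apply: (complete_sub_eq (SG_mulr qG Gg).1 hG.1) => phi.
have [k [f [d [-> _]]]] := pformulaE phi => hphi.
have [d' e] := real_in_U2 hU hMsmall d (eqtp_sym gh).
have : typ_mulr G q h (inst f d').
  apply: (invariant_mulr qG.1 qI _ hphi).
  by apply: (eqtp_sub (g := vsum (vsum (fun i => inr (inl i)) inl)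
    (fun x => inr (inr x))) (eqtp_sym e)) => -[[]|].
by apply: (invariant_pinst hG.1 hI); apply: eqtp_MW e.
Qed.

(** The factor [c] makes this the kernel of the action on the whole orbit, thus a two-sided
    congruence; equality of [p g] and [p h] alone only compares cosets of the stabiliser. *)
Definition gcong (g h : 'I_n -> U) : Prop :=
  forall c, ginG G c -> typ_mulr G p (gop G c g) = typ_mulr G p (gop G c h).

Lemma gcong_same g h : ginG G g -> ginG G h ->
  eqtp (vsum g mU) (vsum h mU) -> gcong g h.
Proof.
move=> Gg Gh gh c Gc; rewrite -!typ_mulrM //.
apply: typ_mulr_same gh => //; first exact: Sinv_mulr.
by rewrite typ_mulrM //; apply: hfg; apply: gopG.
Qed.

Lemma gcong_sym g h : gcong g h -> gcong h g.
Proof. by move=> gh c /gh. Qed.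

Lemma gcong_trans g h k : gcong g h -> gcong h k -> gcong g k.
Proof. by move=> gh hk c Gc; rewrite gh // hk. Qed.

Lemma gcong_mulr g h k : ginG G g -> ginG G h -> ginG G k -> gcong g h ->
  gcong (gop G g k) (gop G h k).
Proof.
move=> Gg Gh Gk gh c Gc; have Gcg := gopG Gc Gg; have Gch := gopG Gc Gh.
rewrite !gopA // -(typ_mulrM pG Gcg Gk) -(typ_mulrM pG Gch Gk).
by rewrite gh.
Qed.

Lemma gcong_mull g h k : ginG G g -> ginG G h -> ginG G k -> gcong g h ->
  gcong (gop G k g) (gop G k h).
Proof. by move=> Gg Gh Gk gh c Gc; rewrite !gopA // gh //; apply: gopG. Qed.

Lemma gcong_mul g g' h h' : ginG G g -> ginG G g' -> ginG G h -> ginG G h' ->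
  gcong g g' -> gcong h h' -> gcong (gop G g h) (gop G g' h').
Proof.
move=> Gg Gg' Gh Gh' gg hh.
by apply: (@gcong_trans _ (gop G g' h)); [apply: gcong_mulr|apply: gcong_mull].
Qed.

Lemma gcong_inv g h : ginG G g -> ginG G h -> gcong g h ->
  gcong (ginv G g) (ginv G h).
Proof.
move=> Gg Gh gh; have Gg' := ginvG Gg; have Gh' := ginvG Gh.
have := gcong_mull Gg Gh Gg' gh; rewrite gopVl // => H.
have := gcong_mulr (goneG G) (gopG Gg' Gh) Gh' H.
by rewrite gop1l // gopK // => /gcong_sym.
Qed.

Lemma gcong_typ g h : ginG G g -> ginG G h -> gcong g h ->
  typ_mulr G p g = typ_mulr G p h.
Proof. by move=> Gg Gh /(_ _ (goneG G)); rewrite !gop1l. Qed.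

(** [cls q g] : the class of [g] modulo [gcong] is that of the realisations of
    [q] restricted to [M]. *)
Definition cls q g := exists b,
  [/\ ginG G b, realizes b (restrict_type M q) & gcong b g].

Lemma realizes_M q : SG G q ->
  exists2 b, ginG G b & realizes b (restrict_type M q).
Proof.
move=> qG; have [b Gb hb] := realize_type qG (@finite_set0 U).
by exists b => //; apply: realizes_sub hb => x; left.
Qed.

Lemma realizes_cong q b b' : SG G q -> realizes b (restrict_type M q) ->
  realizes b' (restrict_type M q) -> gcong b b'.
Proof.
move=> qG h h'; apply: gcong_same.
- exact: realizes_G h.
- exact: realizes_G h'.
- by apply: (realizes_same qG.1 _ h h') => x; apply: svalP.
Qed.

Lemma cls_ex q : SG G q -> exists2 g, ginG G g & cls q g.
Proof. by move=> /realizes_M[b Gb hb]; exists b => //; exists b; split. Qed.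

Lemma cls_uniq q g h : SG G q -> cls q g -> cls q h -> gcong g h.
Proof.
move=> qG [b [Gb hb bg]] [b' [Gb' hb' bh]].
apply: (gcong_trans (gcong_sym bg)); apply: gcong_trans bh.
exact: realizes_cong hb hb'.
Qed.

Lemma cls_cong q g h : cls q g -> gcong g h -> cls q h.
Proof.
by move=> [b [Gb hb bg]] gh; exists b; split=> //; apply: gcong_trans bg gh.
Qed.

(** If [b] realises [s] over [M] and [a] realises [q] over [M] and [b], then [a * b] realises
    [q * s] over [M]. *)
Lemma cls_mul q s g h : Sinv G M q -> SG G s -> ginG G g -> ginG G h ->
  cls q g -> cls s h -> cls (mul q s) (gop G g h).
Proof.
move=> qI sG Gg Gh qg [b [Gb hb bh]]; have qG : SG G q by case: qI.
have [|a Ga ha] := realize_type qG (B := range b).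
  exact/finite_image/finite_finset.
have ha' : realizes a (restrict_type M q) by apply: realizes_sub ha => x; left.
exists (gop G a b); split; first exact: gopG.
  move=> phi [hphi Mphi]; apply/holds_fmulr => //; apply: ha; split.
    exact/(newelskiE qI sG _ Mphi hb).
  by apply: over_fmulr => [i|u /Mphi]; [right; exists i|left].
apply: gcong_mul => //.
by apply: (@cls_uniq q) => //; exists a; split.
Qed.

Lemma cls_inv q g : SG G q -> ginG G g -> cls q g ->
  cls (typ_inv G q) (ginv G g).
Proof.
move=> qG Gg [b [Gb hb bg]]; exists (ginv G b); split.
- exact: ginvG.
- move=> phi [h Mphi]; apply/holds_finv => //; apply: hb; split=> //.
  exact: over_finv.
- exact: gcong_inv.
Qed.

Lemma cls_mulr a g : ginG G a -> ginG G g -> cls p a ->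
  cls (typ_mulr G p g) (gop G a g).
Proof.
move=> Ga Gg pa; have [|b Gb hb] := realize_type pG (B := range g).
  exact/finite_image/finite_finset.
exists (gop G b g); split; first exact: gopG.
  move=> phi [h Mphi]; apply/holds_fmulr => //; apply: hb; split=> //.
  by apply: over_fmulr => [i|u /Mphi]; [right; exists i|left].
apply: gcong_mulr => //; apply: (@cls_uniq p) => //; exists b; split=> //.
by apply: realizes_sub hb => x; left.
Qed.

(** The class of [p g] is that of [a * g], with [a] a realisation of [p] over [M], and [a]
    cancels. *)
Lemma cls_orbr_inj q q' k : ginG G k ->
  typ_orbr G p (ginG G) q -> typ_orbr G p (ginG G) q' ->
  cls q k -> cls q' k -> q = q'.
Proof.
move=> Gk [g Gg <-] [h Gh <-] hg hh; have [a Ga pa] := cls_ex pG.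
have Gag := gopG Ga Gg; have Gah := gopG Ga Gh; have Ga' := ginvG Ga.
have H : gcong (gop G a g) (gop G a h).
  apply: (@gcong_trans _ k).
    by apply: cls_uniq (cls_mulr Ga Gg pa) hg; apply: SG_mulr.
  by apply: cls_uniq hh (cls_mulr Ga Gh pa); apply: SG_mulr.
apply: gcong_typ => //.
by have := gcong_mull Gag Gah Ga' H; rewrite !gopKl.
Qed.

Lemma cls_orbr_surj k : ginG G k ->
  exists2 q, typ_orbr G p (ginG G) q & cls q k.
Proof.
move=> Gk; have [a Ga pa] := cls_ex pG; have Ga' := ginvG Ga.
have Gg := gopG Ga' Gk; exists (typ_mulr G p (gop G (ginv G a) k)).
  by exists (gop G (ginv G a) k).
by have := cls_mulr Ga Gg pa; rewrite gopA // gopV // gop1l.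
Qed.

(** The product uses a realisation [b'] of [s] that depends on the formula; modulo [gcong] all of
    them agree with one [b], so multiplying by [s] is translating by [b]. *)
Lemma newelski_orbr q s : typ_orbr G p (ginG G) q -> SG G s ->
  typ_orbr G p (ginG G) (mul q s).
Proof.
move=> [g Gg <-] sG; have [b Gb hb] := realizes_M sG.
have Ggb := gopG Gg Gb; exists (gop G g b) => //.
apply/seteqP; suff H phi :
    typ_mulr G p (gop G g b) phi <-> mul (typ_mulr G p g) s phi.
  by split=> phi /H.
have over_phi : over (M `|` params phi) phi by move=> u hu; right.
have [b' [Gb' hb' ->]] := newelski_real (Sinv_mulr Gg) sG (finite_params phi)
  over_phi.
have bb' : gcong b b'.
  by apply: (realizes_cong sG hb); apply: realizes_sub hb' => x; left.
by rewrite bb' // -(typ_mulrM pG Gg Gb').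
Qed.

End Generic.
End Newelski.

(** * Closures and limits of types *)

Section Topology.
Variables (L : language) (U : fostruct L) (n : nat).
Implicit Types (A S : set (typ U n)) (y : typ U n).

(** A basic neighbourhood is cut out by finitely many formulas; among complete types it contains the
    one given by their conjunction. *)
Lemma closure_typP A y : A `<=` @complete_type L U n -> complete_type y ->
  closure A y <-> forall phi, y phi -> exists2 x, A x & x phi.
Proof.
move=> AC yC; split=> [cl phi yphi|H B].
  have [|x [Ax xphi]] := cl [set x : typ U n | x phi]; last by exists x.
  apply: open_nbhs_nbhs; split=> //.
  exists [set [set x : typ U n | x phi]]; last by rewrite bigcup_set1.
  by move=> _ ->; apply: finI_from1; exists phi.
rewrite nbhsE => -[C [[D' D'sub <-] [C0 D'C0 C0y]] CB].
have [X XD XE] := D'sub _ D'C0.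
suff [phi yphi hphi] : exists2 phi, y phi &
    forall x, complete_type x -> x phi -> C0 x.
  have [x Ax xphi] := H _ yphi; exists x; split=> //; apply: CB.
  by exists C0 => //; apply: hphi => //; apply: AC.
have [k [b bE]] := finite_setE (finite_fset X).
have /choice[g hg] : forall i, exists phi, b i = [set x : typ U n | x phi].
  move=> i; have : range b (b i) by exists i.
  by rewrite -bE => /XD; rewrite inE => -[phi _ <-]; exists phi.
have [||i|psi ypsi hpsi] := type_bigand (p := y) (g := g).
- exact: type_inhabited yC.2.
- by move=> phi psi h1 h2; apply: (complete_and yC h1 h2).
- have bi : range b (b i) by exists i.
  by move: C0y; rewrite -XE bE => /(_ _ bi); rewrite hg.
exists psi => // x xC xpsi; rewrite -XE bE => _ [i _ <-]; rewrite hg.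
by apply: (complete_mp xC xpsi) => a /hpsi.
Qed.

Lemma closure_in_typP S A y : A `<=` S -> S `<=` @complete_type L U n ->
  closure_in S A y <->
  S y /\ forall phi, y phi -> exists2 x, A x & x phi.
Proof.
move=> AS SC; have AC := subset_trans AS SC.
rewrite /closure_in closure_subspaceW //.
split=> [[cl Sy]|[Sy H]].
  by split=> //; apply/(closure_typP AC) => //; apply: SC.
by split=> //; apply/(closure_typP AC) => //; apply: SC.
Qed.

Lemma closed_in_typP S A : A `<=` S -> S `<=` @complete_type L U n ->
  closed_in S A <-> forall y, S y ->
    (forall phi, y phi -> exists2 x, A x & x phi) -> A y.
Proof.
move=> AS SC; rewrite /closed_in closure_id.
split=> [E y Sy H|H].
  have : closure_in S A y by apply/(closure_in_typP _ AS SC).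
  by rewrite /closure_in -E.
apply/seteqP; split; first exact: subset_closure.
move=> y cl.
by have [] := iffLR (closure_in_typP y AS SC) cl; apply: H.
Qed.

End Topology.

(** * Limits along ultrafilters *)

Section Limits.
Variables (L : language) (U : fostruct L) (n : nat) (G : defgroup U n).

(** The ultrafilter lives on the index set, so a second family over the same indices can be followed
    along it; this is how limits are lifted through [F] and through translation. *)
Lemma ultra_types (I : Type) (z : I -> typ U n) (S : set I) (y : typ U n) :
  complete_type y -> (forall i, S i -> complete_type (z i)) ->
  (forall phi, y phi -> exists2 i, S i & z i phi) ->
  exists UF : set_system I, [/\ UltraFilter UF, UF S &
    forall phi, y phi -> UF [set i | z i phi]].
Proof.
move=> yC zC H.
pose B phi : set I := [set i | S i /\ z i phi].
have FF : ProperFilter (filter_from y B).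
  apply: filter_from_proper; last first.
    by move=> phi /H[i Si zi]; exists i.
  apply: filter_from_filter.
    exact: type_inhabited yC.2.
  move=> phi psi yphi ypsi; exists (fAnd phi psi).
    exact: (complete_and yC yphi ypsi).
  move=> i [Si zi]; split; split=> //;
    by apply: (complete_mp (zC i Si) zi) => a [].
have [UF [UU sub]] := ultraFilterLemma FF; exists UF; split=> //.
  have [phi yphi] := type_inhabited yC.2.
  by apply: sub; exists phi => // i [].
by move=> phi yphi; apply: sub; exists phi => // i [].
Qed.

Definition ulim (I : Type) (UF : set_system I) (x : I -> typ U n) : typ U n :=
  [set phi | UF [set i | x i phi]].

Lemma SG_ulim (I : Type) (UF : set_system I) (x : I -> typ U n) (S : set I) :
  UltraFilter UF -> UF S -> (forall i, S i -> SG G (x i)) -> SG G (ulim UF x).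
Proof.
move=> UU US xG; split; last by apply: filterS US => i /xG[].
apply: complete_typeI => [phi psi h1 h2|phi h|phi].
- apply: (filterS _ (filterI US (filterI h1 h2))) => i [/xG xi [x1 x2]].
  exact: (complete_and xi.1 x1 x2).
- have [i [/xG xi]] := filter_ex (filterI US h).
  exact: complete_sat xi.1.
- have [h|h] := in_ultra_setVsetC [set i | x i phi] UU; [by left|right].
  apply: (filterS _ (filterI US h)) => i [/xG xi nx].
  exact/(complete_not _ xi.1).
Qed.

End Limits.

(** * The retraction and the group *)

Section RetractionGroup.
Variables (L : language) (K : Type) (U : fostruct L) (hU : monster K U).
Hypothesis hNIP : NIP U.
Variables (M : set U) (hM : elementary_substruct M).
Hypothesis hMsmall : card_lt M [set: K].
Variables (n : nat) (G : defgroup U n).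
Variables (N' : fostruct (Lpair L)) (j : U -> reduct N').
Hypothesis hj : elementary (U1 := pair_struct M) (U2 := N') j.
Hypothesis hN' : saturated (fun A : set N' => A #<= [set: U]).
Implicit Types (p q s : typ U n).

Local Notation Mt := {x : U | M x}.
Local Notation mU := (sval : Mt -> U).
Local Notation F := (@retraction L U M N' j n).
Local Notation mul := (newelski G M).

Lemma retraction_Sfs q : Sinv G M q -> Sfs G M (F q).
Proof.
move=> [[qC qG] qI]; split; last exact: (retraction_fs hU hMsmall hj qC qI).
split; first exact: (retraction_complete hU hM hMsmall hj hN' hNIP qC qI).
apply: (retraction_over hU hM hMsmall hj qC qI) => //; exact: over_gdom.
Qed.

Lemma retraction_inv q : Sinv G M q -> F (typ_inv G q) = typ_inv G (F q).
Proof.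
move=> qI; have [[qC qG] qI'] := qI.
have [qvG qvI] := Sinv_inv qI.
have FS1 := retraction_Sfs (Sinv_inv qI); have FS2 := retraction_Sfs qI.
apply/esym; apply: (complete_sub_eq (SG_inv FS2.1).1 FS1.1.1) => theta.
pose R (W : fostruct L) (w : 'I_n + Mt -> W) y := inv_rel G (w \o inl) y.
apply: (@retraction_push _ _ _ hU _ hM hMsmall _ _ hj n q (inv_graph G) (gdom G) R)
  => //.
- by move=> W u a y; apply: sat_inv_graph.
- apply: exp_and; first exact: (exp_sat (g := inr)).
  apply: exp_ex; apply: exp_and.
    by apply: (exp_sat (g := vsum (vsum (fun i => inl (inl (inl i)))
      (fun i => inl (inr i))) inr)) => ? ? [[]|].
  by apply: (exp_sat (g := vsum (vsum inr inr) inr)) => ? ? [[]|].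
- by move=> a Ga; exists (ginv G a) => y; apply: inv_relP.
- by case: qvG.
Qed.

Lemma retraction_mulr q g : Sinv G M q -> gpoints G M g ->
  invariant M (typ_mulr G q g) -> F (typ_mulr G q g) = typ_mulr G (F q) g.
Proof.
move=> qI [Gg Mg] gI; have [qG qI'] := qI; have [qC qD] := qG.
have gG := SG_mulr qG Gg.
have FS1 : Sfs G M (F (typ_mulr G q g)) by apply: retraction_Sfs.
have FS2 := retraction_Sfs qI.
apply/esym; apply: (complete_sub_eq (SG_mulr FS2.1 Gg).1 FS1.1.1) => theta.
pose R (W : fostruct L) (w : 'I_n + Mt -> W) y :=
  sat (vsum (vsum (w \o inl) (fun i => w (inr (exist _ (g i) (Mg i))))) y) (gmul G).
apply: (@retraction_push _ _ _ hU _ hM hMsmall _ _ hj n q _ (gdom G) R) => //.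
- by move=> W u a y; apply: sat_mulr_graph.
- by apply: (exp_sat (g := vsum (vsum (fun i => inl (inl i))
    (fun i => inl (inr (exist _ (g i) (Mg i))))) inr)) => ? ? [[]|].
- by move=> a Ga; exists (gop G a g) => y; apply: gopP.
- by case: gG.
Qed.

(** [F q] and [q] have the same restriction to [M]. *)
Lemma cls_retraction p q g : Sinv G M q -> cls M G p q g -> cls M G p (F q) g.
Proof.
move=> qI [b [Gb hb bg]]; exists b; split=> // phi [h Mphi].
have [[qC qG] qI'] := qI; apply: hb; split=> //.
have [//|/(retraction_over hU hM hMsmall hj qC qI') nq] := qC.2 phi.
have /(complete_not _ (retraction_Sfs qI).1.1) := nq Mphi.
by [].
Qed.

(** As [b] realises [q^-1] over [A], the point [b^-1] realises [q] there, and
    [(g^-1 * b)^-1 = b^-1 * g]. *)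
Lemma mul_gpoint q b g phi (A : set U) : SG G q -> gpoints G M g ->
  ginG G b -> M `<=` A -> over A phi ->
  realizes b (restrict_type A (typ_inv G q)) ->
  holds (fmulr G b (finv_subst G phi)) (ginv G g) <-> typ_mulr G q g phi.
Proof.
move=> qG [Gg Mg] Gb MA Aphi hb; have Gg' := ginvG Gg; have Gb' := ginvG Gb.
have qvG := SG_inv qG.
have : typ_inv G (typ_inv G q) (fmulr G g phi) <-> typ_mulr G q g phi.
  by rewrite typ_invK.
move=> <-.
have oA : over A (finv_subst G (fmulr G g phi)).
  by apply: over_finv; apply: over_fmulr => // i; apply: MA.
rewrite -[typ_inv G (typ_inv G q) _]/(typ_inv G q (finv_subst G (fmulr G g phi))).
rewrite (propext (realizes_iff qvG.1 hb oA)) (propext (holds_finv _ Gb)).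
rewrite (propext (holds_fmulr _ Gg Gb')) (propext (holds_fmulr _ Gb Gg')).
by rewrite (propext (holds_finv _ (gopG Gg' Gb))) ginvM // ginvK.
Qed.

Lemma Sfs_complete : Sfs G M `<=` @complete_type L U n.
Proof. by move=> q [[]]. Qed.

Lemma Sfs_mulr q g : Sfs G M q -> gpoints G M g -> Sfs G M (typ_mulr G q g).
Proof.
move=> qF GMg; have Gg : ginG G g by case: GMg.
split; first by apply: SG_mulr => //; case: qF.
move=> phi /(SG_gpoint qF)[m GMm /holds_fmulr hm].
have [_ Mmg] := gpoints_gop hM GMm GMg.
by exists (gop G m g); split=> //; apply: hm => //; case: GMm.
Qed.

(** Up to inversion, the closure of an orbit [q G(M)] is the left ideal
    generated by the inverse of [q] : the types of points of [G(M)] are dense,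
    and the product is continuous in its left argument. *)
Lemma closure_orbit q y : Sfs G M q ->
  closure_in (Sfs G M) (typ_orbr G q (gpoints G M)) y <->
  exists2 s, Sfs G M s & y = typ_inv G (mul s (typ_inv G q)).
Proof.
move=> qF; have [qG _] := qF; have qvF := Sfs_inv hM qF; have qvG := SG_inv qG.
have over_par (phi : pformula U n) : over (M `|` params phi) phi.
  by move=> u hu; right.
have subM (phi : pformula U n) : M `<=` M `|` params phi by move=> x; left.
have orbF : typ_orbr G q (gpoints G M) `<=` Sfs G M.
  by move=> _ [g GMg <-]; apply: Sfs_mulr.
rewrite (propext (closure_in_typP y orbF Sfs_complete)); split; last first.
  move=> [s sF ->]; split.
    exact/(Sfs_inv hM)/(Sfs_newelski hU hM hMsmall).
  move=> phi; rewrite /typ_inv /=.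
  have oinv := over_finv (G := G) (over_par phi).
  have [b [Gb hb ->]] := newelski_real hU hMsmall (Sfs_Sinv sF) qvG
    (finite_params phi) oinv.
  move=> /(SG_gpoint sF)[m GMm].
  have GMg := gpoints_ginv hM GMm; have [Gm _] := GMm.
  rewrite -{1}(ginvK Gm).
  move=> /(mul_gpoint qG GMg Gb (@subM phi) (over_par phi) hb) h.
  by exists (typ_mulr G q (ginv G m)) => //; exists (ginv G m).
move=> [yF H]; have [[yC yG] yfs] := yF.
have [g|phi /H [_ [g GMg <-] h]|UF [UU US hUF]] :=
    @ultra_types _ _ _ _ (fun g => typ_mulr G q g) (gpoints G M) y yC.
- by case=> Gg _; case: (SG_mulr qG Gg).
- by exists g.
(* [y] is the limit of [q g] along [UF]; the required [s] is the limit, along the same ultrafilter,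
   of the types of the points [g^-1]. *)
pose x (g : 'I_n -> U) : typ U n := [set phi | holds phi (ginv G g)].
have xG g : gpoints G M g -> SG G (x g).
  move=> [Gg _]; split; last by apply/holds_gdom; apply: ginvG.
  apply: complete_typeI => [phi psi|phi|phi].
  - by rewrite /x /= /holds.
  - by move=> h; exists (ginv G g).
  - exact: EM.
have sG : SG G (ulim UF x) by apply: SG_ulim US xG.
have sF : Sfs G M (ulim UF x).
  split=> // phi h; have [g [/(gpoints_ginv hM)[_ Mg] hg]] := filter_ex (filterI US h).
  by exists (ginv G g).
exists (ulim UF x) => //.
have [prodG _] := Sfs_newelski hU hM hMsmall sF qvF.
apply: (complete_sub_eq yC (SG_inv prodG).1) => phi yphi.
rewrite /typ_inv /=.
have oinv := over_finv (G := G) (over_par phi).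
have [b [Gb hb ->]] := newelski_real hU hMsmall (Sfs_Sinv sF) qvG
  (finite_params phi) oinv.
apply: (filterS _ (filterI US (hUF _ yphi))) => g [GMg h].
exact/(mul_gpoint qG GMg Gb (@subM phi) (over_par phi) hb).
Qed.

(** If [y] is a limit of types [F q] with [q] in [A], the limit [s] of these [q] along the same
    ultrafilter is invariant and lies in [A], and [F s = y] by continuity. *)
Lemma retraction_closed (A : set (typ U n)) : A `<=` Sinv G M ->
  closed_in (Sinv G M) A -> closed_in (Sfs G M) (F @` A).
Proof.
have SinvC : Sinv G M `<=` @complete_type L U n by move=> q [[]].
move=> AI /(closed_in_typP AI SinvC) clA.
apply/closed_in_typP => [_ [q Aq <-]||y yF H].
- exact/retraction_Sfs/AI.
- exact: Sfs_complete.
have [[yC yG] yfs] := yF.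
have [q|phi /H [_ [q Aq <-] h]|UF [UU US hUF]] :=
    @ultra_types _ _ _ _ (fun q => F q) A y yC.
- by move=> Aq; case: (retraction_Sfs (AI _ Aq)) => [[]].
- by exists q.
pose s := ulim UF (fun q => q).
have sG : SG G s by apply: SG_ulim US _ => q /AI[].
have sI : Sinv G M s.
  split=> // k f b c bc; split=> h; apply: (filterS _ (filterI US h));
    by move=> q [/AI[_ /(_ k f b c bc) [h1 h2]]].
have As : A s.
  apply: clA => // phi h; have [q [Aq hq]] := filter_ex (filterI US h).
  by exists q.
exists s => //; have [[FsC _] _] := retraction_Sfs sI.
apply: (complete_sub_eq FsC yC) => theta.
move=> /(retraction_continuous hU hM hMsmall hj hN' hNIP sG.1 sI.2)[psi spsi hpsi].
have [//|ny] := yC.2 theta.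
have [q [Aq [hq nq]]] := filter_ex (filterI US (filterI spsi (hUF _ ny))).
have [[qC qG] qI] := AI _ Aq.
have [[FqC _] _] := retraction_Sfs (AI _ Aq).
by move/(complete_not _ FqC): nq; case; apply: hpsi.
Qed.

End RetractionGroup.

(** * The ideal and Ellis subgroup conditions *)

Section EllisGroup.
Variables (L : language) (K : Type) (U : fostruct L) (hU : monster K U).
Hypothesis hNIP : NIP U.
Variables (M : set U) (hM : elementary_substruct M).
Hypothesis hMsmall : card_lt M [set: K].
Variables (n : nat) (G : defgroup U n).
Variables (N' : fostruct (Lpair L)) (j : U -> reduct N').
Hypothesis hj : elementary (U1 := pair_struct M) (U2 := N') j.
Hypothesis hN' : saturated (fun A : set N' => A #<= [set: U]).
Variable p : typ U n.
Hypotheses (hp : Sinv G M p) (hfg : strong_right_fgeneric G M p).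
Implicit Types (q s x y : typ U n).

Local Notation F := (@retraction L U M N' j n).
Local Notation mul := (newelski G M).
Local Notation inv := (typ_inv G).
Local Notation pG := (typ_orbr G p (ginG G)).
Local Notation FGp := (F @` typ_orbl G (ginG G) (typ_inv G p)).
Local Notation FS := (Sfs G M).
Local Notation cl := (cls M G p).

Let FI q : Sinv G M q -> F (inv q) = inv (F q) :=
  @retraction_inv _ _ _ hU hNIP _ hM hMsmall _ G _ _ hj hN' q.
Let FSfs q : Sinv G M q -> FS (F q) :=
  @retraction_Sfs _ _ _ hU hNIP _ hM hMsmall _ G _ _ hj hN' q.

Lemma orbr_Sinv q : pG q -> Sinv G M q.
Proof. by move=> [g Gg <-]; apply: Sinv_mulr. Qed.

Lemma orbr_self : pG p.
Proof.
by exists (gone G); [exact: goneG|apply: typ_mulr1; case: hp].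
Qed.

Lemma FGpE : FGp = [set inv (F q) | q in pG].
Proof.
have [pS _] := hp; rewrite typ_orbl_inv //.
apply/seteqP; split=> [_ [_ [q qO <-] <-]|_ [q qO <-]].
  by exists q => //; rewrite FI //; apply: orbr_Sinv.
by exists (inv q); [exists q|rewrite FI //; apply: orbr_Sinv].
Qed.

Lemma FGp_intro q : pG q -> FGp (inv (F q)).
Proof. by move=> qO; rewrite FGpE; exists q. Qed.

Lemma FGp_FS x : FGp x -> FS x.
Proof.
rewrite FGpE => -[q /orbr_Sinv qI <-]; apply: (Sfs_inv hM); exact: FSfs.
Qed.

Lemma cls_invF q g : Sinv G M q -> ginG G g -> cl q g ->
  cl (inv (F q)) (ginv G g).
Proof.
move=> qI Gg qg; apply: cls_inv => //; first by case: (FSfs qI).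
exact: (cls_retraction hU hNIP hM hMsmall hj hN').
Qed.

(** The class of [(F q)^-1] is inverse to that of [q], and within the orbit [q] is determined by its
    class. *)
Lemma FGp_inj x y k : ginG G k -> FGp x -> FGp y -> cl x k -> cl y k -> x = y.
Proof.
move=> Gk; rewrite FGpE => -[q qO <-] [q' qO' <-] hx hy.
have Gk' := ginvG Gk.
suff H r : pG r -> cl (inv (F r)) k -> cl r (ginv G k).
  by congr (inv (F _)); apply: (cls_orbr_inj hU hMsmall hp hfg Gk') => //; apply: H.
move=> rO hr; have rI := orbr_Sinv rO; have [rG _] := rI.
have [g Gg rg] := cls_ex hU hMsmall p rG.
have [FrG _] := FSfs rI; have FrvG := SG_inv FrG.
have H := cls_uniq hU hMsmall hp hfg FrvG (cls_invF rI Gg rg) hr.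
apply: (cls_cong rg).
have := gcong_inv hp (ginvG Gg) Gk H.
by rewrite ginvK.
Qed.

Lemma FGp_surj k : ginG G k -> exists2 x, FGp x & cl x k.
Proof.
move=> Gk; have [q qO qk] := cls_orbr_surj hU hMsmall hp hfg (ginvG Gk).
exists (inv (F q)); first exact: FGp_intro.
by rewrite -(ginvK Gk); apply: cls_invF => //; [exact: orbr_Sinv|exact: ginvG].
Qed.

Lemma FS_SG x : FS x -> SG G x.
Proof. by case. Qed.

Lemma FS_clsM x y g h : FS x -> FS y -> ginG G g -> ginG G h ->
  cl x g -> cl y h -> cl (mul x y) (gop G g h).
Proof.
move=> xF yF; apply: (cls_mul hU hMsmall hp hfg (Sfs_Sinv xF) (FS_SG yF)).
Qed.

Definition ideal_absorbed := forall s, FS s -> FGp (mul s (inv (F p))).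

(** [t] is taken in [FGp] of class [k * l^-1]; absorption puts [t * F(p)^-1] in [FGp], where its
    class [k] identifies it with [x]. *)
Lemma absorbed_factor x : ideal_absorbed -> FGp x ->
  exists2 t, FS t & x = mul t (inv (F p)).
Proof.
move=> H0 xO; have KpO := FGp_intro orbr_self.
have [k Gk xk] := cls_ex hU hMsmall p (FS_SG (FGp_FS xO)).
have [l Gl Kl] := cls_ex hU hMsmall p (FS_SG (FGp_FS KpO)).
have Gl' := ginvG Gl; have Gkl := gopG Gk Gl'.
have [t tO tkl] := FGp_surj Gkl; have tF := FGp_FS tO.
exists t => //; apply: (FGp_inj Gk xO (H0 t tF) xk).
have := FS_clsM tF (FGp_FS KpO) Gkl Gl tkl Kl.
by rewrite gopVK.
Qed.

Lemma absorbed_left_ideal : ideal_absorbed -> left_ideal FS mul FGp.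
Proof.
move=> H0; split.
- by exists (inv (F p)); apply: FGp_intro orbr_self.
- exact: FGp_FS.
move=> s x sF xO; have [t tF ->] := absorbed_factor H0 xO.
rewrite -(newelskiA hU hM hMsmall) //; last exact/FGp_FS/FGp_intro/orbr_self.
exact/H0/(Sfs_newelski hU hM hMsmall).
Qed.

Lemma left_ideal_absorbed : left_ideal FS mul FGp -> ideal_absorbed.
Proof. by move=> [_ _ h] s sF; apply: h => //; apply: FGp_intro orbr_self. Qed.

(** Classes form a group, so from any [x] of a smaller ideal every [y] is reached as [t * x], with
    [t] of class [l * k^-1]. *)
Lemma left_ideal_minimal : left_ideal FS mul FGp ->
  minimal_left_ideal FS mul FGp.
Proof.
move=> lI; split=> // J [[x Jx] JF Jmul] JO; apply/seteqP; split=> // y yO.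
have xO := JO _ Jx; have [_ _ Omul] := lI.
have [k Gk xk] := cls_ex hU hMsmall p (FS_SG (FGp_FS xO)).
have [l Gl yl] := cls_ex hU hMsmall p (FS_SG (FGp_FS yO)).
have Gk' := ginvG Gk; have Glk := gopG Gl Gk'.
have [t tO tlk] := FGp_surj Glk; have tF := FGp_FS tO.
suff -> : y = mul t x by apply: Jmul.
apply: (FGp_inj Gl yO (Omul _ _ tF xO) yl).
by have := FS_clsM tF (FGp_FS xO) Glk Gk tlk xk; rewrite gopVK.
Qed.

Lemma left_ideal_Ellis : left_ideal FS mul FGp -> Ellis_subgroup FS mul FGp.
Proof.
move=> lI; have mI := left_ideal_minimal lI; have [_ _ Omul] := lI.
(* The element of neutral class is a left identity on [FGp], hence idempotent, and [u * FGp] is all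
   of [FGp]. *)
have [u uO u1] := FGp_surj (goneG G); have uF := FGp_FS uO.
have uid x : FGp x -> mul u x = x.
  move=> xO; have xF := FGp_FS xO.
  have [k Gk xk] := cls_ex hU hMsmall p (FS_SG xF).
  apply: (FGp_inj Gk (Omul _ _ uF xO) xO) => //.
  by have := FS_clsM uF xF (goneG G) Gk u1 xk; rewrite gop1l.
exists FGp, u; split=> //; first exact: uid.
apply/seteqP; split=> [x xO|_ [x xO <-]]; last by rewrite uid.
by exists x => //; apply: uid.
Qed.

Lemma antimorphism_cls q s : Sinv G M q -> Sinv G M s -> Sinv G M (mul q s) ->
  FGp (inv (F (mul q s))) -> FGp (mul (inv (F s)) (inv (F q))) ->
  inv (F (mul q s)) = mul (inv (F s)) (inv (F q)).
Proof.
move=> qI sI qsI O1 O2; have [qG _] := qI; have [sG _] := sI.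
have [g Gg qg] := cls_ex hU hMsmall p qG.
have [h Gh sh] := cls_ex hU hMsmall p sG.
have Ggh := gopG Gg Gh; apply: (FGp_inj (ginvG Ggh) O1 O2).
  apply: cls_invF => //; exact: (cls_mul hU hMsmall hp hfg).
rewrite ginvM //; apply: FS_clsM; try exact: ginvG.
- exact/(Sfs_inv hM)/FSfs.
- exact/(Sfs_inv hM)/FSfs.
- exact: cls_invF.
- exact: cls_invF.
Qed.

Lemma absorbed_antimorphism : ideal_absorbed ->
  forall q, Sinv G M q -> inv (F (mul p q)) = mul (inv (F q)) (inv (F p)).
Proof.
move=> H0 q qI; have pqO : pG (mul p q).
  by apply: (newelski_orbr hU hMsmall hp hfg orbr_self); case: qI.
apply: antimorphism_cls => //; first exact: orbr_Sinv.
  exact: FGp_intro.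
exact/H0/(Sfs_inv hM)/FSfs.
Qed.

(** For [q = s^-1] with [s] finitely satisfiable, [F] fixes [q] and the right side is [s * F(p)^-1];
    the left side is in [FGp] because [p * q] stays in the orbit. *)
Lemma antimorphism_absorbed :
  (forall q, Sinv G M q -> inv (F (mul p q)) = mul (inv (F q)) (inv (F p))) ->
  ideal_absorbed.
Proof.
move=> H s sF; have svF := Sfs_inv hM sF; have svI := Sfs_Sinv svF.
have := H _ svI.
rewrite (retraction_id hU hM hMsmall hj hN' hNIP svI.1.1 svI.2 svF.2).
rewrite typ_invK; last exact: FS_SG.
move=> <-; apply: FGp_intro.
by apply: (newelski_orbr hU hMsmall hp hfg orbr_self); case: svI.
Qed.

Lemma absorbed_closure : ideal_absorbed <->
  closure_in FS (typ_orbr G (F p) (gpoints G M)) `<=` F @` pG.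
Proof.
have pF := FSfs hp; split=> [H0 y|H s sF].
  move=> /(closure_orbit hU hM hMsmall y pF)[s sF ->].
  have := H0 _ sF; rewrite FGpE => -[q qO <-]; exists q => //.
  by rewrite typ_invK //; apply: FS_SG; apply/FSfs/orbr_Sinv.
have [|q qO E] := H (inv (mul s (inv (F p)))).
  by apply/(closure_orbit hU hM hMsmall _ pF); exists s.
have sG : SG G (mul s (inv (F p))).
  by apply: FS_SG; apply: (Sfs_newelski hU hM hMsmall) => //; apply: (Sfs_inv hM).
by rewrite -(typ_invK sG) -E; apply: FGp_intro.
Qed.

Lemma absorbed_closure_eq : ideal_absorbed ->
  closure_in FS (typ_orbr G (F p) (gpoints G M)) = F @` pG.
Proof.
move=> H0; apply/seteqP; split; first exact/absorbed_closure.
move=> _ [q qO <-]; have qI := orbr_Sinv qO.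
apply/(closure_orbit hU hM hMsmall _ (FSfs hp)).
have [t tF E] := absorbed_factor H0 (FGp_intro qO).
by exists t => //; rewrite -E typ_invK //; apply/FS_SG/FSfs.
Qed.

Lemma FpG_FS : F @` pG `<=` FS.
Proof. by move=> _ [q /orbr_Sinv qI <-]; apply: FSfs. Qed.

Lemma orbit_FpG : typ_orbr G (F p) (gpoints G M) `<=` F @` pG.
Proof.
move=> _ [g [Gg Mg] <-]; exists (typ_mulr G p g); first by exists g.
by apply: (retraction_mulr hU hNIP hM hMsmall hj hN' hp) => //; apply: hfg.
Qed.

(** For the converse, the inclusion already forces equality by [absorbed_closure_eq], so the set is
    itself a closure. *)
Lemma closed_FpG : closed_in FS (F @` pG) <->
  closure_in FS (typ_orbr G (F p) (gpoints G M)) `<=` F @` pG.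
Proof.
have orbF := subset_trans orbit_FpG FpG_FS; have FSC := @Sfs_complete _ _ M _ G.
rewrite (propext (closed_in_typP FpG_FS FSC)); split=> [H y|].
  move=> /(closure_in_typP _ orbF FSC)[yF yH]; apply: H => // phi /yH[x xO xphi].
  by exists x => //; apply: orbit_FpG.
move=> /absorbed_closure/absorbed_closure_eq <- y yF H.
apply/(closure_in_typP _ orbF FSC); split=> // phi /H[x].
by move=> /(closure_in_typP _ orbF FSC)[_]; apply.
Qed.

(** [(u * a) * (u * b) = u * (a * (u * b))], and [a * (u * b)] stays in the left ideal. *)
Lemma Ellis_subgroup_mul (E : set (typ U n)) x y :
  Ellis_subgroup FS mul E -> E x -> E y -> E (mul x y).
Proof.
move=> [I [u [[[_ IF Imul] _] Iu uu ->]]] [a Ia <-] [b Ib <-].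
have [uF aF bF] := And3 (IF _ Iu) (IF _ Ia) (IF _ Ib).
exists (mul a (mul u b)); first exact: (Imul _ _ aF (Imul _ _ uF Ib)).
by rewrite -(newelskiA hU hM hMsmall) //; apply: (Sfs_newelski hU hM hMsmall).
Qed.

Lemma KM_image : (fun q => F (inv q)) @` pG = FGp.
Proof.
rewrite FGpE; apply/seteqP; split=> _ [q qO <-]; exists q => //;
  by rewrite FI //; apply: orbr_Sinv.
Qed.

Lemma KM_inj q s : pG q -> pG s -> inv (F q) = inv (F s) -> q = s.
Proof.
move=> qO sO E; have qI := orbr_Sinv qO; have sI := orbr_Sinv sO.
have [g Gg qg] := cls_ex hU hMsmall p qI.1.
have [h Gh sh] := cls_ex hU hMsmall p sI.1.
apply: (cls_orbr_inj hU hMsmall hp hfg Gg qO sO qg).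
have FqG := SG_inv (FS_SG (FSfs qI)).
have hq := cls_invF qI Gg qg; have hs := cls_invF sI Gh sh.
rewrite -E in hs.
have := gcong_inv hp (ginvG Gh) (ginvG Gg) (cls_uniq hU hMsmall hp hfg FqG hs hq).
by rewrite !ginvK //; apply: cls_cong.
Qed.

(** Comparing classes in the anti-homomorphism law requires [F(s)^-1 * F(q)^-1] to lie in [FGp],
    which holds as an Ellis subgroup is closed under products. Conversely, bijectivity makes [E] the
    image of the orbit, which is [FGp]. *)
Lemma Ellis_anti_isomorphism : Ellis_subgroup FS mul FGp <->
  exists2 E, Ellis_subgroup FS mul E &
    anti_isomorphism mul pG E (fun q => F (inv q)).
Proof.
split=> [EF|[E EE [_ [fE injE surjE] _]]]; last first.
  suff -> : FGp = E by [].
  rewrite -KM_image; apply/seteqP; split=> [_ [q qO <-]|x /surjE //].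
  exact: fE.
exists FGp => //; split.
- move=> q s qO sO; apply: (newelski_orbr hU hMsmall hp hfg qO).
  by case: (orbr_Sinv sO).
- split.
  + by move=> q qO; rewrite -KM_image; exists q.
  + move=> q s; rewrite !inE => qO sO; rewrite !FI; try exact: orbr_Sinv.
    exact: KM_inj.
  + by rewrite /set_surj KM_image.
- move=> q s qO sO; have qI := orbr_Sinv qO; have sI := orbr_Sinv sO.
  have qsO : pG (mul q s).
    by apply: (newelski_orbr hU hMsmall hp hfg qO); case: sI.
  have qsI := orbr_Sinv qsO.
  rewrite !FI //; apply: antimorphism_cls => //; first exact: FGp_intro.
  by apply: Ellis_subgroup_mul => //; apply: FGp_intro.
Qed.

Lemma orbr_closed_FpG : closed_in (Sinv G M) pG -> closed_in FS (F @` pG).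
Proof.
by apply: (retraction_closed hU hNIP hM hMsmall hj hN') => q /orbr_Sinv.
Qed.

End EllisGroup.

Unset Implicit Arguments.

Theorem theorem4p24 (L : language) (K : Type) (U : fostruct L)
  (hU : monster K U) (hNIP : NIP U)
  (M : set U) (hM : elementary_substruct M) (hMsmall : card_lt M [set: K])
  (n : nat) (G : defgroup U n)
  (N' : fostruct (Lpair L)) (j : U -> reduct N')
  (hj : elementary (U1 := pair_struct M) (U2 := N') j)
  (hN' : saturated (fun A : set N' => A #<= [set: U]))
  (p : typ U n) (hp : Sinv G M p) (hfg : strong_right_fgeneric G M p) :
  let mul := newelski G M in
  let inv := typ_inv G in
  let GU := ginG G in
  let GM := gpoints G M in
  let F := retraction M j (n := n) in
  let KM := fun q => F (inv q) in
  let FS := Sfs G M in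
  let pG := typ_orbr G p GU in
  let FpG := F @` pG in
  let clFpGM := closure_in FS (typ_orbr G (F p) GM) in
  let FGp := F @` typ_orbl G GU (inv p) in
  let c1 := closed_in (Sinv G M) pG in
  let c2 := clFpGM `<=` FpG in
  let c3 := clFpGM = FpG in
  let c4 := closed_in FS FpG in
  let c5 := left_ideal FS mul FGp in
  let c6 := minimal_left_ideal FS mul FGp /\ Ellis_subgroup FS mul FGp in
  let c7 := forall q, Sinv G M q ->
              inv (F (mul p q)) = mul (inv (F q)) (inv (F p)) in
  let c8 := Ellis_subgroup FS mul FGp in
  let c9 := exists2 E, Ellis_subgroup FS mul E & anti_isomorphism mul pG E KM in
  [/\ c1 -> [/\ c2, c3, c4 & c5] /\ [/\ c6, c7, c8 & c9],
      [/\ c2 <-> c3, c2 <-> c4, c2 <-> c5, c2 <-> c6 & c2 <-> c7],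
      c2 -> c8 /\ c9
    & c8 <-> c9].
Proof.
move=> mul inv GU GM F KM FS pG FpG clFpGM FGp c1 c2 c3 c4 c5 c6 c7 c8 c9.
have i02 := absorbed_closure hU hNIP hM hMsmall hj hN' hp hfg.
have i24 := closed_FpG hU hNIP hM hMsmall hj hN' hp hfg.
have i89 := Ellis_anti_isomorphism hU hNIP hM hMsmall hj hN' hp hfg.
have i05 := absorbed_left_ideal hU hNIP hM hMsmall hj hN' hp hfg.
have i50 := left_ideal_absorbed hU hNIP hM hMsmall hj hN' hp hfg.
have i56 := left_ideal_minimal hU hNIP hM hMsmall hj hN' hp hfg.
have i58 := left_ideal_Ellis hU hNIP hM hMsmall hj hN' hp hfg.
have i07 := absorbed_antimorphism hU hNIP hM hMsmall hj hN' hp hfg.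
have i70 := antimorphism_absorbed hU hNIP hM hMsmall hj hN' hp hfg.
have i03 := absorbed_closure_eq hU hNIP hM hMsmall hj hN' hp hfg.
have i14 := orbr_closed_FpG hU hNIP hM hMsmall hj hN' hp hfg.
have c23 : c2 <-> c3 by split=> [/i02/i03//|h]; rewrite /c2 h.
have c24 : c2 <-> c4 by split=> /i24.
have c25 : c2 <-> c5 by split=> [/i02/i05//|/i50/i02].
have c26 : c2 <-> c6.
  by split=> [/c25 h|[[/c25]]//]; split; [exact: i56|exact: i58].
have c27 : c2 <-> c7 by split=> [/i02/i07//|/i70/i02].
have c28 : c2 -> c8 /\ c9.
  by move=> /c25 h; have h8 : c8 := i58 h; split=> //; exact/i89.
split=> //.
move=> /i14/i24 h2; have [h8 h9] := c28 h2.
split; split=> //; [exact/c23|exact/c24|exact/c25|exact/c26|exact/c27].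
Qed.
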